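(* Let $n\in\mathbb{N}$, $n\geq 2$, and let $A$ be a ring which is not a field. The following are equivalent: (i) $A$ is a local real closed SV-ring of rank at most $n$. (ii) $A$ is a local real closed ring, and there exist non-trivial real closed valuation rings $A_1,\dots,A_n$ and an injective ring homomorphism $\epsilon:A\to\prod_{i=1}^nA_i$ such that $\epsilon(A)$ is a subdirect product of $A_1,\dots,A_n$ (i.e. each coordinate projection maps $\epsilon(A)$ onto $A_i$). (iii) There exist non-trivial real closed valuation rings $A_1,\dots,A_n$ and an injective ring homomorphism $\epsilon:A\to\prod_{i=1}^nA_i$ such that $(\pi^n_1\circ\epsilon)(A)=A_1$ and, for all $j\in\{1,\dots,n-1\}$, there are prime ideals $\mathfrak{i}_j\subsetneq(\pi^n_j\circ\epsilon)(A)$ and $\mathfrak{j}_{j+1}\subsetneq A_{j+1}$ with an isomorphism $(\pi^n_j\circ\epsilon)(A)/\mathfrak{i}_j\cong A_{j+1}/\mathfrak{j}_{j+1}$ such that $(\pi^n_{j+1}\circ\epsilon)(A)=(\pi^n_j\circ\epsilon)(A)\times_{A_{j+1}/\mathfrak{j}_{j+1}}A_{j+1}$ as subrings of $\prod_{i=1}^{j+1}A_i$ (the fibre product taken along the quotient map composed with this isomorphism and along the quotient map $A_{j+1}\to A_{j+1}/\mathfrak{j}_{j+1}$); in particular $A\cong(\pi^n_n\circ\epsilon)(A)=(\cdots((A_1\times_{A_2/\mathfrak{j}_2}A_2)\times_{A_3/\mathfrak{j}_3}A_3)\cdots\times_{A_{n-1}/\mathfrak{j}_{n-1}}A_{n-1})\times_{A_n/\mathfrak{j}_n}A_n$.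 (iv) There exist prime ideals $\mathfrak{p}_1,\dots,\mathfrak{p}_n$ of $A$ such that $\bigcap_{i=1}^n\mathfrak{p}_i=(0)$, $\mathfrak{q}_j:=\left(\bigcap_{i=1}^{j-1}\mathfrak{p}_i\right)+\mathfrak{p}_j$ is a prime ideal for all $j\in\{2,\dots,n\}$, $A/\mathfrak{p}_i$ is a non-trivial real closed valuation ring for every $i$, and the canonical map $a\mapsto(a/\mathfrak{p}_1,\dots,a/\mathfrak{p}_n)$ restricts to an isomorphism $A\cong(\cdots((A/\mathfrak{p}_1\times_{A/\mathfrak{q}_2}A/\mathfrak{p}_2)\times_{A/\mathfrak{q}_3}A/\mathfrak{p}_3)\cdots\times_{A/\mathfrak{q}_{n-1}}A/\mathfrak{p}_{n-1})\times_{A/\mathfrak{q}_n}A/\mathfrak{p}_n$. Moreover, if any of (i)–(iv) holds and $\mathrm{rk}(A)=n$, then the prime ideals $\mathfrak{p}_1,\dots,\mathfrak{p}_n$ in (iv) are pairwise incomparable under inclusion and are exactly the minimal prime ideals of $A$.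
   Context: Rings are commutative unital. A ring $A$ is real closed if: (i) reduced; (ii) the squares are exactly the non-negative elements of a partial order $\leq$ making $(A,\leq)$ an $f$-ring (all binary suprema/infima exist, $c(a\wedge b)=ca\wedge cb$ for $c\geq0$); (iii) $0\leq a\leq b$ implies $bc=a^2$ for some $c$; (iv) for every prime $\mathfrak{p}$, $\mathrm{qf}(A/\mathfrak{p})$ is real closed and $A/\mathfrak{p}$ integrally closed. A real closed valuation ring is a real closed ring which is a valuation ring; it is non-trivial if it is not a field. $A$ is an SV-ring if $A/\mathfrak{p}$ is a valuation ring for every prime $\mathfrak{p}$. The rank of a local ring is the number of its minimal prime ideals. For $j\leq n$, $\pi^n_j:\prod_{i=1}^nA_i\to\prod_{i=1}^jA_i$ is the projection onto the first $j$ coordinates. Fibre product: $A\times_C B=\{(a,b): f(a)=g(b)\}$ for given maps $f:A\to C$, $g:B\to C$; in the iterated fibre products the maps are the canonical quotient maps. *)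

(* Defs.v *)
From HB Require Import structures.
From mathcomp Require Import all_boot all_order all_algebra.
From mathcomp Require Import generic_quotient ring_quotient fraction.
From mathcomp Require Import boolp classical_sets functions cardinality.

Set Implicit Arguments.
Unset Strict Implicit.
Unset Printing Implicit Defensive.

Import GRing.Theory.
Local Open Scope classical_set_scope.
Local Open Scope card_scope.
Local Open Scope ring_scope.
Local Open Scope quotient_scope.

(* Ideals are the library's [idealr] (proper ideals) and [prime_idealr] (prime
   ideals).  These are boolean predicates, but with the classical axioms of
   [boolp] every subset of a ring is of this form. *)

Section Ideals.
Variable A : comNzRingType.

Lemma prime_idealr_ext (p q : prime_idealr A) : p =i q -> p = q.
Proof.
case: p => p [[c1] [c2] [c3] [c4]]; case: q => q [[d1] [d2] [d3] [d4]] pq.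
have pqE : p = q by apply: funext => x; have := pq x; rewrite !unfold_in.
subst q; rewrite (Prop_irrelevance c1 d1) (Prop_irrelevance c2 d2).
by rewrite (Prop_irrelevance c3 d3) (Prop_irrelevance c4 d4).
Qed.

Definition maximal_ideal (m : idealr A) : Prop :=
  forall I : idealr A, {subset m <= I} -> {subset I <= m}.

Definition minimal_prime (p : prime_idealr A) : Prop :=
  forall q : prime_idealr A, {subset q <= p} -> {subset p <= q}.

End Ideals.

Definition local_ring (A : comNzRingType) : Prop :=
  exists2 m : idealr A, maximal_ideal m &
    forall m' : idealr A, maximal_ideal m' -> m' =i m.

(* The number of minimal primes may be infinite, so the rank is only compared
   with natural numbers, through cardinality of sets. *)
Definition rank_at_most (A : comNzRingType) (n : nat) : Prop :=
  [set p : prime_idealr A | minimal_prime p] #<= `I_n.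

Definition rank_equal (A : comNzRingType) (n : nat) : Prop :=
  [set p : prime_idealr A | minimal_prime p] #= `I_n.

Definition is_field (A : comNzRingType) : Prop :=
  forall x : A, x != 0 -> exists y, x * y = 1.

Definition is_domain (A : comNzRingType) : Prop :=
  forall x y : A, x * y = 0 -> x = 0 \/ y = 0.

Definition valuation_ring (A : comNzRingType) : Prop :=
  is_domain A /\
  forall a b : A, (exists c, b = a * c) \/ (exists c, a = b * c).

Definition SV_ring (A : comNzRingType) : Prop :=
  forall p : prime_idealr A, valuation_ring {ideal_quot p}.

(* [dom_quot p] is A/p; the alias carries the integral domain structure that
   [{fraction _}] requires, the inverse of a unit being chosen classically. *)
Definition dom_quot (A : comNzRingType) (p : prime_idealr A) : Type :=
  {ideal_quot p}.

Section DomQuot.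
Variables (A : comNzRingType) (p : prime_idealr A).

HB.instance Definition _ := GRing.ComNzRing.copy (dom_quot p) {ideal_quot p}.

Let dq_unit : {pred dom_quot p} := fun x => `[< exists y, y * x = 1 >].
Let dq_inv (x : dom_quot p) : dom_quot p := xget x [set y | y * x = 1].

Fact dom_quot_mulVr : {in dq_unit, left_inverse 1 dq_inv *%R}.
Proof. by move=> x /asboolP ux; exact: (xgetPex x ux). Qed.

Fact dom_quot_unitP (x y : dom_quot p) : y * x = 1 -> dq_unit x.
Proof. by move=> yx1; apply/asboolP; exists y. Qed.

Fact dom_quot_inv_out : {in [predC dq_unit], dq_inv =1 id}.
Proof.
move=> x; rewrite inE => /asboolP nux; rewrite /dq_inv xgetPN // => y yx1.
by apply: nux; exists y.
Qed.

HB.instance Definition _ := GRing.ComNzRing_hasMulInverse.Build (dom_quot p)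
  dom_quot_mulVr dom_quot_unitP dom_quot_inv_out.

HB.instance Definition _ := GRing.ComUnitRing_isIntegral.Build (dom_quot p)
  (@Quotient.rquot_IdomainAxiom A p).

End DomQuot.

Definition real_closed_field (K : fieldType) : Prop :=
  exists (F : rcfType) (phi : {rmorphism K -> F}), bijective phi.

Definition integrally_closed (D : idomainType) : Prop :=
  forall x : {fraction D}, integralOver (@FracField.tofrac D) x ->
  exists d : D, x = FracField.tofrac d.

Section FRing.
Variables (A : comNzRingType) (le : A -> A -> Prop).

Definition is_inf (a b m : A) : Prop :=
  [/\ le m a, le m b & forall x, le x a -> le x b -> le x m].

Definition is_sup (a b s : A) : Prop :=
  [/\ le a s, le b s & forall x, le a x -> le b x -> le s x].

Record f_ring_order : Prop := FRingOrder {
  fr_refl : forall a, le a a;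
  fr_anti : forall a b, le a b -> le b a -> a = b;
  fr_trans : forall a b c, le a b -> le b c -> le a c;
  fr_add : forall a b c, le a b -> le (a + c) (b + c);
  fr_mul : forall a b, le 0 a -> le 0 b -> le 0 (a * b);
  fr_inf : forall a b, exists m, is_inf a b m;
  fr_sup : forall a b, exists s, is_sup a b s;
  fr_mul_inf : forall a b m c,
    le 0 c -> is_inf a b m -> is_inf (c * a) (c * b) (c * m)
}.

End FRing.

(* The order is determined by the squares, so that the last clause under the
   existential speaks about the order of the ring. *)
Definition real_closed_ring (A : comNzRingType) : Prop :=
  [/\ forall (x : A) (k : nat), x ^+ k = 0 -> x = 0,
      exists le : A -> A -> Prop,
        [/\ f_ring_order le,
            forall a, le 0 a <-> exists b, a = b ^+ 2
          & forall a b, le 0 a -> le a b -> exists c, b * c = a ^+ 2]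
    & forall p : prime_idealr A,
        real_closed_field {fraction (dom_quot p)} /\
        integrally_closed (dom_quot p)].

Definition nontrivial_rcvr (A : comNzRingType) : Prop :=
  [/\ real_closed_ring A, valuation_ring A & ~ is_field A].

(* Finite families are indexed from 0 and extended to all of [nat]; the values
   at indices outside the stated range are never used.  [rprod A_ j] is the
   product of A_ 0, ..., A_ (j - 1). *)
Definition rprod (A_ : nat -> comNzRingType) (j : nat) : Type :=
  forall i : 'I_j, A_ i.

Section RProd.
Variables (A_ : nat -> comNzRingType).

HB.instance Definition _ j := Choice.copy (rprod A_ j) (forall i : 'I_j, A_ i).

Section Ring.
Variable j : nat.
Let P := rprod A_ j.

Let rp_zero : P := fun=> 0.
Let rp_opp (x : P) : P := fun i => - x i.
Let rp_add (x y : P) : P := fun i => x i + y i.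
Let rp_one : P := fun=> 1.
Let rp_mul (x y : P) : P := fun i => x i * y i.

Fact rprod_addA : associative rp_add.
Proof. by move=> x y z; apply: functional_extensionality_dep => i; exact: addrA. Qed.
Fact rprod_addC : commutative rp_add.
Proof. by move=> x y; apply: functional_extensionality_dep => i; exact: addrC. Qed.
Fact rprod_add0 : left_id rp_zero rp_add.
Proof. by move=> x; apply: functional_extensionality_dep => i; exact: add0r. Qed.
Fact rprod_addN : left_inverse rp_zero rp_opp rp_add.
Proof. by move=> x; apply: functional_extensionality_dep => i; exact: addNr. Qed.
Fact rprod_mulA : associative rp_mul.
Proof. by move=> x y z; apply: functional_extensionality_dep => i; exact: mulrA. Qed.
Fact rprod_mulC : commutative rp_mul.
Proof. by move=> x y; apply: functional_extensionality_dep => i; exact: mulrC. Qed.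
Fact rprod_mul1 : left_id rp_one rp_mul.
Proof. by move=> x; apply: functional_extensionality_dep => i; exact: mul1r. Qed.
Fact rprod_mulD : left_distributive rp_mul rp_add.
Proof. by move=> x y z; apply: functional_extensionality_dep => i; exact: mulrDl. Qed.

HB.instance Definition _ := GRing.isZmodule.Build (rprod A_ j)
  rprod_addA rprod_addC rprod_add0 rprod_addN.
HB.instance Definition _ := GRing.Zmodule_isComPzRing.Build (rprod A_ j)
  rprod_mulA rprod_mulC rprod_mul1 rprod_mulD.

End Ring.

Fact rprod_oner_neq0 j : (1 : rprod A_ j.+1) != 0.
Proof.
apply/eqP => /(congr1 (fun x : rprod A_ j.+1 => x ord0)) /eqP.
by rewrite oner_eq0.
Qed.

HB.instance Definition _ j :=
  GRing.PzSemiRing_isNonZero.Build (rprod A_ j.+1) (rprod_oner_neq0 j).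

Definition proj (n j : nat) (le_jn : (j <= n)%N) (x : rprod A_ n) :
  rprod A_ j := fun i => x (widen_ord le_jn i).

Section ProjMorphism.
Variables (n j : nat) (le_jn : (j <= n)%N).

Fact proj_zmod : zmod_morphism (proj le_jn). Proof. by []. Qed.
Fact proj_monoid : monoid_morphism (proj le_jn). Proof. by []. Qed.

HB.instance Definition _ :=
  GRing.isZmodMorphism.Build (rprod A_ n) (rprod A_ j) (proj le_jn) proj_zmod.
HB.instance Definition _ :=
  GRing.isMonoidMorphism.Build (rprod A_ n) (rprod A_ j) (proj le_jn)
    proj_monoid.

End ProjMorphism.

(* The fibre product S x_C A_ j, for S a subset of A_ 0 x ... x A_ (j - 1), as
   a subset of A_ 0 x ... x A_ j. *)
Definition fibre_product (j : nat) (S : set (rprod A_ j)) (C : Type)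
    (f : S -> C) (g : A_ j -> C) : set (rprod A_ j.+1) :=
  [set x | exists2 s : S, val s = proj (leqnSn j) x & f s = g (x ord_max)].

End RProd.

(* The image of a ring morphism, as a subring of its codomain. *)
Section ImageRing.
Variables (A R : comNzRingType) (f : {rmorphism A -> R}).

Definition im_pred : {pred R} := [pred y | y \in range f].

Fact im_pred_subring : subring_closed im_pred.
Proof.
split=> [|x y|x y]; rewrite !inE; first by exists 1; rewrite ?rmorph1.
  by move=> [a _ <-] [b _ <-]; exists (a - b); rewrite ?rmorphB.
by move=> [a _ <-] [b _ <-]; exists (a * b); rewrite ?rmorphM.
Qed.

HB.instance Definition _ :=
  GRing.isSubringClosed.Build R im_pred im_pred_subring.

Definition im_ring : Type := set_type (range f).

HB.instance Definition _ := SubChoice.copy im_ring {x | im_pred x}.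
HB.instance Definition _ :=
  [SubChoice_isSubComNzRing of im_ring by <:].

End ImageRing.

Definition local_rc_SV_rank_at_most (A : comNzRingType) (n : nat) : Prop :=
  [/\ local_ring A, real_closed_ring A, SV_ring A & rank_at_most A n].

Definition local_rc_subdirect (A : comNzRingType) (n : nat) : Prop :=
  [/\ local_ring A, real_closed_ring A
    & exists (A_ : nat -> comNzRingType) (eps : {rmorphism A -> rprod A_ n}),
        [/\ forall i, (i < n)%N -> nontrivial_rcvr (A_ i),
            injective eps
          & forall i : 'I_n, range (fun a => eps a i) = [set: A_ i]]].

Definition im_proj (A : comNzRingType) (A_ : nat -> comNzRingType) (n j : nat)
    (eps : {rmorphism A -> rprod A_ n}) (lt_jn : (j < n)%N) : comNzRingType :=
  im_ring (proj lt_jn \o eps : {rmorphism A -> rprod A_ j.+1}).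

(* The iterated fibre product is unfolded into its successive stages: each
   stage is the image of A in A_ 0 x ... x A_ j. *)
Definition iterated_fibre_embedding (A : comNzRingType) (n : nat)
    (le2n : (2 <= n)%N) : Prop :=
  exists (A_ : nat -> comNzRingType) (eps : {rmorphism A -> rprod A_ n}),
    [/\ forall i, (i < n)%N -> nontrivial_rcvr (A_ i),
        injective eps,
        range (proj (ltnW le2n) \o eps) = [set: rprod A_ 1]
      & forall (j : nat) (lt_jn : (j.+1 < n)%N),
          exists (I : prime_idealr (im_proj eps (ltnW lt_jn)))
                 (J : prime_idealr (A_ j.+1))
                 (theta : {rmorphism {ideal_quot I} -> {ideal_quot J}}),
            bijective theta /\
            range (proj lt_jn \o eps) =
              fibre_product (S := range (proj (ltnW lt_jn) \o eps))
                (fun s : im_proj eps (ltnW lt_jn) =>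
                   theta (\pi_{ideal_quot I} s))
                (fun y : A_ j.+1 => \pi_{ideal_quot J} y)].

Section PrimeFibre.
Variables (A : comNzRingType) (p q : nat -> prime_idealr A).

Definition quot_family (i : nat) : comNzRingType := {ideal_quot (p i)}.

Definition diag (j : nat) (a : A) : rprod quot_family j :=
  fun i => \pi_{ideal_quot (p i)} a.
Arguments diag : clear implicits.

Fact diag_zmod j : zmod_morphism (diag j).
Proof.
by move=> a b; apply: functional_extensionality_dep => i; exact: raddfB.
Qed.

Fact diag_monoid j : monoid_morphism (diag j).
Proof.
split=> [|a b]; apply: functional_extensionality_dep => i.
  exact: rmorph1.
exact: rmorphM.
Qed.

HB.instance Definition _ j :=
  GRing.isZmodMorphism.Build A (rprod quot_family j) (diag j) (diag_zmod j).
HB.instance Definition _ j :=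
  GRing.isMonoidMorphism.Build A (rprod quot_family j) (diag j)
    (diag_monoid j).

(* (a / p 0, ..., a / p (j - 1)) |-> a / q j *)
Definition quot_left (j : nat) (x : rprod quot_family j) :
    {ideal_quot (q j)} :=
  \pi_{ideal_quot (q j)} (xget 0 [set a | diag j a = x]).

(* b / p j |-> b / q j *)
Definition quot_right (j : nat) (y : quot_family j) : {ideal_quot (q j)} :=
  \pi_{ideal_quot (q j)} (repr (y : {ideal_quot (p j)})).

Lemma quot_leftE j a : (forall b, (forall i : 'I_j, b \in p i) -> b \in q j) ->
  quot_left (diag j a) = \pi_{ideal_quot (q j)} a.
Proof.
move=> sub_pq; apply/eqP; rewrite -Quotient.idealrBE; apply: sub_pq => i.
rewrite Quotient.idealrBE; apply/eqP.
have ex_a : [set b | diag j b = diag j a] a by [].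
exact: (congr1 (fun x : rprod quot_family j => x i)
  (xgetPex 0 (ex_intro _ a ex_a))).
Qed.

Lemma quot_rightE j (b : A) : {subset p j <= q j} ->
  @quot_right j (\pi_{ideal_quot (p j)} b) = \pi_{ideal_quot (q j)} b.
Proof.
move=> sub_pq; apply/eqP; rewrite -Quotient.idealrBE; apply: sub_pq.
by rewrite Quotient.idealrBE reprK.
Qed.

Fixpoint iterated_fibre (j : nat) : set (rprod quot_family j) :=
  match j with
  | 0 => [set: rprod quot_family 0]
  | k.+1 =>
      if k == 0%N then [set: rprod quot_family k.+1]
      else fibre_product (S := @iterated_fibre k)
             (fun s => quot_left (val s)) (@quot_right k)
  end.
Arguments iterated_fibre : clear implicits.

Definition prime_fibre_decomposition (n : nat) : Prop :=
  [/\ forall a : A, (forall i, (i < n)%N -> a \in p i) -> a = 0,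
      forall j, (0 < j < n)%N -> forall a : A,
        a \in q j <->
        exists b c : A,
          [/\ forall i, (i < j)%N -> b \in p i, c \in p j & a = b + c],
      forall i, (i < n)%N -> nontrivial_rcvr {ideal_quot (p i)}
    & injective (diag n) /\ range (diag n) = iterated_fibre n].

End PrimeFibre.

(* Main.v *)
From HB Require Import structures.
From Stdlib Require Import setoid_ring.Ring.
Require Import Defs.
From mathcomp Require Import all_boot all_order all_algebra ring_quotient.
From mathcomp Require Import generic_quotient fraction.
From mathcomp Require Import boolp classical_sets functions cardinality.

(* The order of a real closed ring is encoded by its squares: [rc_axioms]
   replaces the lattice operations by a decomposition [a = u - v] into squares
   with [u v = 0].  In this form real closedness passes to quotients that are
   domains and to fibre products of surjections onto a domain, so every stage
   of an iterated fibre product is local and real closed: (iii) implies (ii).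
   If the kernels [p i] of the coordinates of a subdirect embedding meet in 0,
   every prime contains some [p i]; hence A is SV of rank at most n: (ii)
   implies (i).  For (i) implies (iv), enumerate the minimal primes (with
   repetitions).  Radical ideals are convex; by Riesz decomposition and
   existence of square roots a sum of two radical ideals is again radical and
   convex, and it is prime as soon as it is proper and one summand is prime.
   The isomorphism A/(I /\ p) = A/I x_{A/(I + p)} A/p then gives the iterated
   fibre product, and (iv) implies (iii) is a relabelling. *)

Set Implicit Arguments.
Unset Strict Implicit.
Unset Printing Implicit Defensive.

Import GRing.Theory.
Local Open Scope classical_set_scope.
Local Open Scope ring_scope.
Local Open Scope quotient_scope.

(** * Prime ideals, quotients and fraction fields *)

Lemma idealr_of_set (A : comNzRingType) (S : set A) :
  S 0 -> ~ S 1 -> (forall x y, S x -> S y -> S (x + y)) ->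
  (forall a x, S x -> S (a * x)) ->
  exists I : idealr A, forall x, (x \in I) <-> S x.
Proof.
move=> S0 S1 SD SM; pose P : A -> bool := fun x => `[< S x >].
have Pid : idealr_closed P.
  split=> [||a x y]; rewrite ?unfold_in; [exact/asboolP|exact/asboolP|].
  by move=> /asboolP Sx /asboolP Sy; apply/asboolP/SD => //; exact: SM.
pose I : idealr A := HB.pack P (isIdealr.Build A P Pid).
by exists I => x; split=> /asboolP.
Qed.

Lemma prime_idealr_of_set (A : comNzRingType) (S : set A) :
  S 0 -> ~ S 1 -> (forall x y, S x -> S y -> S (x + y)) ->
  (forall a x, S x -> S (a * x)) ->
  (forall x y, S (x * y) -> S x \/ S y) ->
  exists I : prime_idealr A, forall x, (x \in I) <-> S x.
Proof.
move=> S0 S1 SD SM Sp; pose P : A -> bool := fun x => `[< S x >].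
have Pid : idealr_closed P.
  split=> [||a x y]; rewrite ?unfold_in; [exact/asboolP|exact/asboolP|].
  by move=> /asboolP Sx /asboolP Sy; apply/asboolP/SD => //; exact: SM.
have Ppr : prime_idealr_closed P.
  move=> x y /asboolP /Sp [] Sx; apply/orP; [left|right]; exact/asboolP.
pose I : prime_idealr A :=
  HB.pack P (isIdealr.Build A P Pid) (isPrimeIdealrClosed.Build A P Ppr).
by exists I => x; split=> /asboolP.
Qed.

Lemma primeM (A : comNzRingType) (p : prime_idealr A) x y :
  x * y \in p -> x \in p \/ y \in p.
Proof. by rewrite prime_idealrM => /orP. Qed.

Lemma primeX (A : comNzRingType) (p : prime_idealr A) x k :
  x ^+ k \in p -> x \in p.
Proof.
elim: k => [|k IH]; first by rewrite expr0 idealr1.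
by rewrite exprS => /primeM [].
Qed.

Lemma idealMl (A : comNzRingType) (p : idealr A) x y : x \in p -> x * y \in p.
Proof. by move=> px; rewrite mulrC idealMr. Qed.

Definition quot_map (A : comNzRingType) (p : prime_idealr A) :
  {rmorphism A -> {ideal_quot p}} := \pi_{ideal_quot p}.

Lemma quot_map_eq (A : comNzRingType) (p : prime_idealr A) x y :
  quot_map p x = quot_map p y <-> x - y \in p.
Proof. by rewrite Quotient.idealrBE; split=> [/eqP|/eqP]. Qed.

Lemma quot_map_eq0 (A : comNzRingType) (p : prime_idealr A) x :
  quot_map p x = 0 <-> x \in p.
Proof. by rewrite -(rmorph0 (quot_map p)) quot_map_eq subr0. Qed.

Definition onto (T U : Type) (f : T -> U) := forall y, exists x, f x = y.

Lemma onto_quot_map (A : comNzRingType) (p : prime_idealr A) :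
  onto (quot_map p).
Proof. by move=> y; exists (repr y); exact: reprK. Qed.

Lemma quot_domain (A : comNzRingType) (p : prime_idealr A) :
  is_domain {ideal_quot p}.
Proof.
by move=> x y /Quotient.rquot_IdomainAxiom /orP[] /eqP; [left|right].
Qed.

(** Composing [g] with a section of [f] does not depend on the section, because [g] vanishes on the
    kernel of [f]; this makes the composite a morphism. *)
Lemma rmorph_factor (A B C : comNzRingType) (f : {rmorphism A -> B})
    (g : {rmorphism A -> C}) :
  onto f -> (forall a, f a = 0 -> g a = 0) ->
  exists h : {rmorphism B -> C}, forall a, h (f a) = g a.
Proof.
move=> f_onto ker_fg.
have [s sK] : exists s, cancel s f.
  by have [s sK] := choice f_onto; exists s.
pose h b := g (s b).
have hf a : h (f a) = g a.
  apply/eqP; rewrite -subr_eq0 -rmorphB; apply/eqP/ker_fg.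
  by rewrite rmorphB sK subrr.
have hB : zmod_morphism h.
  by move=> x y; rewrite -[x]sK -[y]sK -rmorphB !hf rmorphB.
have hM : monoid_morphism h.
  split=> [|x y]; first by rewrite -(rmorph1 f) hf rmorph1.
  by rewrite -[x]sK -[y]sK -rmorphM !hf rmorphM.
pose hh : {rmorphism B -> C} := HB.pack h
  (GRing.isZmodMorphism.Build B C h hB)
  (GRing.isMonoidMorphism.Build B C h hM).
by exists hh.
Qed.

Lemma rmorph_factor_iso (A B C : comNzRingType) (f : {rmorphism A -> B})
    (g : {rmorphism A -> C}) :
  onto f -> onto g -> (forall a, f a = 0 <-> g a = 0) ->
  exists h : {rmorphism B -> C}, bijective h /\ forall a, h (f a) = g a.
Proof.
move=> f_onto g_onto ker_fg.
have [h hf] : exists h : {rmorphism B -> C}, forall a, h (f a) = g a.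
  by apply: rmorph_factor => // a /ker_fg.
have [k kg] : exists k : {rmorphism C -> B}, forall a, k (g a) = f a.
  by apply: rmorph_factor => // a /ker_fg.
exists h; split=> //; exists k => x.
  by have [a <-] := f_onto x; rewrite hf kg.
by have [a <-] := g_onto x; rewrite kg hf.
Qed.

Lemma prime_comap (A B : comNzRingType) (f : {rmorphism A -> B})
    (P : prime_idealr B) :
  exists p : prime_idealr A, forall a, (a \in p) <-> (f a \in P).
Proof.
apply: (@prime_idealr_of_set A [set a | f a \in P]) => /=.
- by rewrite rmorph0 idealr0.
- by rewrite rmorph1 idealr1.
- by move=> x y fx fy; rewrite rmorphD rpredD.
- by move=> a x fx; rewrite rmorphM idealMr.
- by move=> x y; rewrite rmorphM; exact: primeM.
Qed.

Lemma prime_image (A B : comNzRingType) (f : {rmorphism A -> B})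
    (p : prime_idealr A) :
  onto f -> (forall a, f a = 0 -> a \in p) ->
  exists P : prime_idealr B, forall a, (f a \in P) <-> (a \in p).
Proof.
move=> f_onto ker_p.
have imp a : (f @` [set` p]) (f a) <-> a \in p.
  split=> [[b /= pb eqf]|pa]; last by exists a.
  by rewrite -(subrK b a) rpredD // ker_p // rmorphB eqf subrr.
have [P PE] : exists P : prime_idealr B,
    forall y, (y \in P) <-> (f @` [set` p]) y.
  apply: prime_idealr_of_set.
  - by rewrite -(rmorph0 f) imp idealr0.
  - by rewrite -(rmorph1 f) imp idealr1.
  - move=> x y; have [a <-] := f_onto x; have [b <-] := f_onto y.
    by rewrite -rmorphD !imp; exact: rpredD.
  - move=> x y; have [a <-] := f_onto x; have [b <-] := f_onto y.
    by rewrite -rmorphM !imp; exact: idealMr.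
  - move=> x y; have [a <-] := f_onto x; have [b <-] := f_onto y.
    by rewrite -rmorphM !imp; exact: primeM.
by exists P => a; rewrite PE imp.
Qed.

Lemma onto_comp (T U V : Type) (f : T -> U) (g : U -> V) :
  onto f -> onto g -> onto (g \o f).
Proof. by move=> fo go z; have [y <-] := go z; have [x <-] := fo y; exists x. Qed.

Lemma quot_iso (A B C : comNzRingType) (f : {rmorphism A -> B})
    (g : {rmorphism A -> C}) (I : prime_idealr B) (J : prime_idealr C) :
  onto f -> onto g -> (forall a, (f a \in I) <-> (g a \in J)) ->
  exists h : {rmorphism {ideal_quot I} -> {ideal_quot J}},
    bijective h /\ forall a, h (quot_map I (f a)) = quot_map J (g a).
Proof.
move=> fo go fgE.
have [||a|h [hb hE]] :=
    @rmorph_factor_iso A _ _ (quot_map I \o f) (quot_map J \o g).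
- exact/onto_comp/onto_quot_map.
- exact/onto_comp/onto_quot_map.
- by rewrite /= !quot_map_eq0.
- by exists h.
Qed.

Lemma fractionP (D : idomainType) (x : {fraction D}) :
  exists a b : D, b != 0 /\ x = FracField.tofrac a / FracField.tofrac b.
Proof.
elim/quotW: x => r; exists (\n_r), (\d_r); split; first exact: denom_ratioP.
have d0 := denom_ratioP r.
have F0 : FracField.tofrac (\d_r) != 0 by rewrite tofrac_eq0.
apply: (mulIf F0); rewrite divfK //.
unlock FracField.tofrac; rewrite -[LHS]FracField.pi_mul; apply/eqmodP => /=.
rewrite FracField.equivfE /FracField.mulf !numden_Ratio ?mulf_neq0 ?oner_eq0 //.
by rewrite !mulr1 mulrC.
Qed.

Lemma fraction_extend (D : idomainType) (K : fieldType)
    (f : {rmorphism D -> K}) :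
  injective f ->
  exists F : {rmorphism {fraction D} -> K},
    forall d, F (FracField.tofrac d) = f d.
Proof.
move=> f_inj.
have fn0 d : d != 0 -> f d != 0.
  by apply: contra => /eqP; rewrite -(rmorph0 f) => /f_inj ->.
have tn0 (d : D) : d != 0 -> FracField.tofrac d != 0 by rewrite tofrac_eq0.
have /choice [nd ndP] : forall x, exists ab : D * D,
    ab.2 != 0 /\ x = FracField.tofrac ab.1 / FracField.tofrac ab.2.
  by move=> x; have [a [b ab]] := fractionP x; exists (a, b).
(* Fractions are represented by chosen pairs; cross-multiplication in [FE] shows that the value does
   not depend on the choice. *)
pose F x := f (nd x).1 / f (nd x).2.
have FE a b : b != 0 -> F (FracField.tofrac a / FracField.tofrac b) = f a / f b.
  move=> b0; rewrite /F.
  have [d0 /eqP] := ndP (FracField.tofrac a / FracField.tofrac b).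
  rewrite eqr_div ?tn0 // -!tofracM tofrac_eq => /eqP eqab.
  by apply/eqP; rewrite eqr_div ?fn0 // -!rmorphM eqab.
have F1 a : F (FracField.tofrac a) = f a.
  by have := FE a 1 (oner_neq0 _); rewrite tofrac1 rmorph1 !divr1.
have FB : zmod_morphism F.
  move=> x y; have [a [b [b0 ->]]] := fractionP x; have [c [d [d0 ->]]] := fractionP y.
  rewrite -mulNr addf_div ?tn0 // -tofracN -!tofracM -tofracD.
  rewrite !FE ?mulf_neq0 // -mulNr addf_div ?fn0 //.
  by rewrite rmorphD !rmorphM rmorphN.
have FM : monoid_morphism F.
  split=> [|x y]; first by rewrite -tofrac1 F1 rmorph1.
  have [a [b [b0 ->]]] := fractionP x; have [c [d [d0 ->]]] := fractionP y.
  by rewrite mulf_div -!tofracM !FE ?mulf_neq0 // !rmorphM mulf_div.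
pose FF : {rmorphism {fraction D} -> K} := HB.pack F
  (GRing.isZmodMorphism.Build {fraction D} K F FB)
  (GRing.isMonoidMorphism.Build {fraction D} K F FM).
by exists FF.
Qed.

Lemma tofrac_inj (D : idomainType) : injective (@FracField.tofrac D).
Proof. by move=> x y /eqP; rewrite tofrac_eq => /eqP. Qed.

(** The embedding of [E] into [F] extends to fractions. It is onto because the fraction [a / b] over
    [D] comes from [k a / k b], and a field morphism is injective. *)
Lemma real_closed_fraction_iso (D E : idomainType) (h : {rmorphism E -> D}) :
  bijective h -> real_closed_field {fraction D} ->
  real_closed_field {fraction E}.
Proof.
move=> [k hk kh] [F [phi [psi phiK psiK]]].
have [|G GE] := @fraction_extend E F (phi \o @FracField.tofrac D \o h).
  apply: inj_comp; last exact: can_inj hk.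
  by apply: inj_comp; [exact: can_inj phiK|exact: tofrac_inj].
exists F, G.
have G_onto : onto G.
  move=> y; have [a [b [b0 eqy]]] := fractionP (psi y).
  exists (FracField.tofrac (k a) / FracField.tofrac (k b)).
  by rewrite fmorph_div !GE /= !kh -fmorph_div -eqy psiK.
have [s sK] := choice G_onto.
by exists s => // x; apply: (fmorph_inj G); rewrite sK.
Qed.

Lemma integrally_closed_iso (D E : idomainType) (h : {rmorphism E -> D}) :
  bijective h -> integrally_closed D -> integrally_closed E.
Proof.
move=> [k hk kh] icD x [P Pmon Pr].
have [|G GE] := @fraction_extend E {fraction D} (@FracField.tofrac D \o h).
  by apply: inj_comp; [exact: tofrac_inj|exact: can_inj hk].
have [|d Gx] := icD (G x).
  exists (map_poly h P); first exact: monic_map.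
  have -> : map_poly (@FracField.tofrac D) (map_poly h P) =
      map_poly G (map_poly (@FracField.tofrac E) P).
    by rewrite -!map_poly_comp; apply: eq_map_poly => e /=; rewrite GE.
  exact: rmorph_root.
exists (k d); apply: (fmorph_inj G).
by rewrite Gx GE /= kh.
Qed.

Definition real_closed_prime (A : comNzRingType) (p : prime_idealr A) :=
  real_closed_field {fraction (dom_quot p)} /\ integrally_closed (dom_quot p).

Lemma real_closed_prime_onto (A B : comNzRingType) (f : {rmorphism A -> B})
    (p : prime_idealr A) (P : prime_idealr B) :
  onto f -> (forall a, (a \in p) <-> (f a \in P)) ->
  real_closed_prime p <-> real_closed_prime P.
Proof.
move=> fo pP.
have ido : onto (idfun : A -> A) by move=> x; exists x.
(* An isomorphism is built in each direction, since the inverse of a bijective morphism is only a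
   function. *)
have [h [hb _]] := @quot_iso A A B idfun f p P ido fo pP.
have [k [kb _]] := @quot_iso A B A f idfun P p fo ido (fun a => iff_sym (pP a)).
split=> -[rc ic]; split.
- exact: (@real_closed_fraction_iso (dom_quot p) (dom_quot P) k).
- exact: (@integrally_closed_iso (dom_quot p) (dom_quot P) k).
- exact: (@real_closed_fraction_iso (dom_quot P) (dom_quot p) h).
- exact: (@integrally_closed_iso (dom_quot P) (dom_quot p) h).
Qed.

(** * The order of a real closed ring *)

Definition pos (A : comNzRingType) (x : A) := exists y, x = y ^+ 2.

Record rc_axioms (A : comNzRingType) : Prop := RCAxioms {
  rc_reduced : forall (x : A) k, x ^+ k = 0 -> x = 0;
  rc_posD : forall x y : A, pos x -> pos y -> pos (x + y);
  rc_anti : forall x : A, pos x -> pos (- x) -> x = 0;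
  rc_decomp : forall a : A, exists u v,
    [/\ pos u, pos v, u * v = 0 & a = u - v];
  rc_convex : forall a b : A, pos a -> pos (b - a) -> exists c, b * c = a ^+ 2;
  rc_prime : forall p : prime_idealr A, real_closed_prime p
}.

Section Order.
Variable A : comNzRingType.
Implicit Types a b c m s t u v w x y z : A.

(** [ring] matches operations syntactically, so [rng] first folds every instance of the ring
    operations into these names. *)
Let radd x y : A := x + y.
Let rmul x y : A := x * y.
Let ropp x : A := - x.
Let rsub x y : A := x - y.
Let rone : A := 1.
Let rzero : A := 0.

Let comNzRing_ring_theory : ring_theory rzero rone radd rmul rsub ropp eq.
Proof.
split=> //; intros; rewrite /radd /rmul /ropp ?add0r ?mul1r ?mulrDl ?subrr //.
all: first [exact: addrC | exact: addrA | exact: mulrC | exact: mulrA].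
Qed.

Add Ring comNzRing : comNzRing_ring_theory.

Ltac rng :=
  rewrite ?exprS ?expr0 ?mulr1n ?mulr2n;
  repeat match goal with
  | |- context [@GRing.add ?s ?x ?y] =>
      change (@GRing.add s x y) with (radd x y)
  | |- context [@GRing.mul ?s ?x ?y] =>
      change (@GRing.mul s x y) with (rmul x y)
  | |- context [@GRing.opp ?s ?x] => change (@GRing.opp s x) with (ropp x)
  | |- context [@GRing.one ?s] => change (@GRing.one s) with rone
  | |- context [@GRing.zero ?s] => change (@GRing.zero s) with rzero
  end;
  match goal with
  | |- @eq _ ?x ?y => change (@eq (GRing.ComNzRing.sort A) x y)
  end; ring.

Lemma pos_sqr x : pos (x ^+ 2). Proof. by exists x. Qed.
Lemma pos0 : pos (0 : A). Proof. by exists 0; rewrite expr0n. Qed.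
Lemma posM x y : pos x -> pos y -> pos (x * y).
Proof. by move=> [a ->] [b ->]; exists (a * b); rewrite exprMn. Qed.

Section OfFRing.
Variable le : A -> A -> Prop.
Hypotheses (fr : f_ring_order le) (lepos : forall a, le 0 a <-> pos a).

Let leE a b : le a b <-> pos (b - a).
Proof.
rewrite -lepos; split=> h.
  by have := fr_add fr (- a) h; rewrite subrr.
by have := fr_add fr a h; rewrite subrK add0r.
Qed.

Let posD x y : pos x -> pos y -> pos (x + y).
Proof.
move=> px py; have h : le 0 x by rewrite leE subr0.
by rewrite -lepos; apply: (fr_trans fr h); rewrite leE addrAC subrr add0r.
Qed.

Let anti x : pos x -> pos (- x) -> x = 0.
Proof.
by move=> px pNx; apply: (fr_anti fr); rewrite leE ?subr0 ?sub0r.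
Qed.

(* The product [w = u v] of the parts [u], [v] of [a] is at most [u^2 + v^2],
   and it is disjoint from both [u^2] and [v^2]. *)
Let decomp a : exists u v, [/\ pos u, pos v, u * v = 0 & a = u - v].
Proof.
have [m [lema lem0 mmax]] := fr_inf fr a 0.
have pu : pos (a - m) by rewrite -leE.
have pv : pos (- m) by rewrite -[- m]add0r -leE.
exists (a - m), (- m); split=> //; last by rng.
set u := a - m; set v := - m.
have uv0 : is_inf le u v 0.
  split; rewrite ?leE ?subr0 // => x; rewrite !leE => xu xv.
  have : le (x + m) m.
    apply: mmax; rewrite leE.
      by have -> : a - (x + m) = u - x by rewrite /u; rng.
    by have -> : 0 - (x + m) = v - x by rewrite /v; rng.
  by rewrite leE; have -> : m - (x + m) = 0 - x by rng.
have lu : le 0 u by rewrite lepos.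
have lv : le 0 v by rewrite lepos.
have [_ _ umax] := fr_mul_inf fr lu uv0.
have [_ _ vmax] := fr_mul_inf fr lv uv0.
rewrite !mulr0 in umax vmax.
have pw : pos (u * v) by exact: posM.
apply: anti => //.
(* The element [uv - u^2] is below both [vu] and [v^2], whose infimum is 0. Hence [uv <= u^2], so
   [uv] is below both [u^2] and [uv], whose infimum is again 0. *)
have h1 : le (u * v - u * u) 0.
  apply: vmax; rewrite leE.
    have -> : v * u - (u * v - u * u) = u ^+ 2 by rng.
    exact: pos_sqr.
  have -> : v * v - (u * v - u * u) = (u - v) ^+ 2 + u * v by rng.
  by apply: posD => //; exact: pos_sqr.
rewrite -sub0r -leE; apply: umax; rewrite leE.
  have -> : u * u - u * v = 0 - (u * v - u * u) by rng.
  by rewrite -leE.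
by rewrite subrr; exact: pos0.
Qed.

Lemma rc_axioms_of_f_ring :
  (forall x k, x ^+ k = 0 -> x = 0) ->
  (forall a b, le 0 a -> le a b -> exists c, b * c = a ^+ 2) ->
  (forall p : prime_idealr A, real_closed_prime p) ->
  rc_axioms A.
Proof.
move=> red conv primes; split=> // a b pa pba.
by apply: conv; [rewrite lepos|rewrite leE].
Qed.

End OfFRing.

Section Theory.
Hypothesis rcA : rc_axioms A.

Lemma pos_sum0 x y : pos x -> pos y -> x + y = 0 -> x = 0.
Proof.
move=> px py xy0; apply: (rc_anti rcA) => //.
by have -> : - x = y by rewrite -[LHS]addr0 -xy0; rng.
Qed.

(** Since [u - s = v - t], the negative of [(u - s)^2] is [-(u - s)(v - t) = ut + sv], which is
    positive; so the square is 0. *)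
Lemma decomp_uniq u v s t : pos u -> pos v -> pos s -> pos t ->
  u * v = 0 -> s * t = 0 -> u - v = s - t -> u = s /\ v = t.
Proof.
move=> pu pv ps pt uv st eqd.
have us : u - s = 0.
  apply: (rc_reduced rcA (k := 2)); apply: (rc_anti rcA); first exact: pos_sqr.
  have -> : - (u - s) ^+ 2 = u * t + s * v.
    have e : u - s = v - t.
      have -> : u - s = (u - v) + v - s by rng.
      by rewrite eqd; rng.
    rewrite expr2 {2}e.
    have -> : - ((u - s) * (v - t)) = u * t + s * v - u * v - s * t by rng.
    by rewrite uv st !subr0.
  by apply: (rc_posD rcA); exact: posM.
have eus : u = s by apply/eqP; rewrite -subr_eq0 us.
split=> //; subst s; by apply: oppr_inj; apply: (addrI u).
Qed.

(** This plays the role of the infimum of [u] and [v] being 0. If [t] is the negative part of [y],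
    then [t(y + u) = tu - t^2] and [t(y + v) = tv - t^2] are positive, and a positive combination of
    them equals [t^2 uv - t^4 = -t^4]; hence [t = 0]. *)
Lemma disjoint_pos u v y : pos u -> pos v -> u * v = 0 ->
  pos (y + u) -> pos (y + v) -> pos y.
Proof.
move=> pu pv uv yu yv; have [s [t [ps pt st ye]]] := rc_decomp rcA y.
suff t0 : t = 0 by rewrite ye t0 subr0.
have e1 : t * (y + u) = t * u - t ^+ 2.
  have -> : t * (y + u) = s * t + t * u - t ^+ 2 by rewrite ye; rng.
  by rewrite st add0r.
have e2 : t * (y + v) = t * v - t ^+ 2.
  have -> : t * (y + v) = s * t + t * v - t ^+ 2 by rewrite ye; rng.
  by rewrite st add0r.
apply: (rc_reduced rcA (k := 4)); apply: (rc_anti rcA).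
  have -> : t ^+ 4 = (t ^+ 2) ^+ 2 by rng.
  exact: pos_sqr.
have -> : - t ^+ 4 = (t * u - t ^+ 2) * (t * v) + t ^+ 2 * (t * v - t ^+ 2).
  have -> : (t * u - t ^+ 2) * (t * v) + t ^+ 2 * (t * v - t ^+ 2)
    = t ^+ 2 * (u * v) - t ^+ 4 by rng.
  by rewrite uv mulr0 sub0r.
rewrite -e1 -e2; apply: (rc_posD rcA).
  by apply: posM; exact: posM.
by apply: posM; [exact: pos_sqr|exact: posM].
Qed.

Let le a b := pos (b - a).

(** The infimum is [a] minus the positive part of [a - b]; that it is the greatest lower bound is
    [disjoint_pos]. *)
Let inf_decomp a b u v : pos u -> pos v -> u * v = 0 -> a - b = u - v ->
  is_inf le a b (a - u).
Proof.
move=> pu pv uv eqd.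
have e : b - (a - u) = v.
  have -> : b - (a - u) = u - (a - b) by rng.
  by rewrite eqd; rng.
split; rewrite /le.
- by have -> : a - (a - u) = u by rng.
- by rewrite e.
move=> x xa xb; apply: (disjoint_pos pu pv uv).
  by have -> : a - u - x + u = a - x by rng.
have -> : a - u - x + v = b - x by rewrite -e; rng.
done.
Qed.

Let le_anti a b : le a b -> le b a -> a = b.
Proof.
move=> ab ba; apply/eqP; rewrite -subr_eq0; apply/eqP.
by apply: (rc_anti rcA) => //; rewrite opprB.
Qed.

Let inf_uniq a b m m' : is_inf le a b m -> is_inf le a b m' -> m = m'.
Proof. by move=> [? ? h] [? ? h']; apply: le_anti; [apply: h'|apply: h]. Qed.

Let inf_ex a b : exists m, is_inf le a b m.
Proof.
have [u [v [pu pv uv e]]] := rc_decomp rcA (a - b).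
by exists (a - u); exact: inf_decomp e.
Qed.

Lemma rc_f_ring_order : f_ring_order (fun a b => pos (b - a)).
Proof.
split=> [a|//|a b c ab bc|a b c ab|a b|//|a b|a b m c].
- by rewrite subrr; exact: pos0.
- have -> : c - a = (b - a) + (c - b) by rng.
  exact: (rc_posD rcA).
- by have -> : b + c - (a + c) = b - a by rng.
- by rewrite !subr0; exact: posM.
- have [m [ma mb mm]] := inf_ex (- a) (- b).
  have N x y : le (- x) (- y) <-> le y x.
    by rewrite /le; have -> : - y - - x = x - y by rng.
  exists (- m); split; [by apply/N; rewrite opprK..|] => x ax bx.
  apply/N; rewrite opprK.
  by apply: mm; apply/N.
- rewrite subr0 => pc infm.
  have [u [v [pu pv uv e]]] := rc_decomp rcA (a - b).
  rewrite (inf_uniq infm (inf_decomp pu pv uv e)) mulrBr.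
  (* Multiplication by a positive [c] keeps the parts of [a - b] positive and disjoint, so the
     formula for the infimum is preserved. *)
  apply: (@inf_decomp _ _ _ (c * v)); try exact: posM.
    have -> : c * u * (c * v) = c ^+ 2 * (u * v) by rng.
    by rewrite uv mulr0.
  by rewrite -!mulrBr e.
Qed.

(* Replacing [c] by the infimum of its positive part and [a] keeps [b c]. *)
Lemma rc_convex_le a b : pos a -> pos (b - a) ->
  exists c, [/\ b * c = a ^+ 2, pos c & pos (a - c)].
Proof.
move=> pa pba; have [c0 c0E] := rc_convex rcA pa pba.
have pb : pos b by rewrite -(subrK a b); exact: (rc_posD rcA).
have [u [v [pu pv uv ce]]] := rc_decomp rcA c0.
have [bu _] : b * u = a ^+ 2 /\ b * v = 0.
  apply: decomp_uniq; try exact: posM; try exact: pos0; try exact: pos_sqr.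
  - have -> : b * u * (b * v) = b ^+ 2 * (u * v) by rng.
    by rewrite uv mulr0.
  - by rewrite mulr0.
  - by rewrite -mulrBr -ce c0E subr0.
have [s [t [ps pt st ue]]] := rc_decomp rcA (u - a).
(* Here [b(u - a) = -a(b - a)] is negative, so by uniqueness its positive part [b s] vanishes. The
   witness [u - s] is the infimum of [u] and [a]. *)
have [bs _] : b * s = 0 /\ b * t = a * (b - a).
  apply: decomp_uniq; try exact: posM; try exact: pos0.
  - have -> : b * s * (b * t) = b ^+ 2 * (s * t) by rng.
    by rewrite st mulr0.
  - by rewrite mul0r.
  - rewrite -mulrBr -ue mulrBr bu; rng.
exists (u - s); split.
- by rewrite mulrBr bs bu subr0.
- apply: (disjoint_pos ps pt st).
    by rewrite subrK.
  have -> : u - s + t = u - (s - t) by rng.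
  by rewrite -ue; have -> : u - (u - a) = a by rng.
- have -> : a - (u - s) = s - (u - a) by rng.
  by rewrite ue; have -> : s - (s - t) = t by rng.
Qed.

Lemma rc_abs x : exists a, [/\ pos a, a ^+ 2 = x ^+ 2, pos (a - x) & pos (a + x)].
Proof.
have [u [v [pu pv uv ->]]] := rc_decomp rcA x; exists (u + v); split.
- exact: (rc_posD rcA).
- have -> : (u + v) ^+ 2 = (u - v) ^+ 2 + (u * v + u * v + (u * v + u * v))
    by rng.
  by rewrite uv !addr0.
- have -> : u + v - (u - v) = v + v by rng.
  exact: (rc_posD rcA).
- have -> : u + v + (u - v) = u + u by rng.
  exact: (rc_posD rcA).
Qed.

Lemma pos_root x : pos x -> exists2 y, pos y & x = y ^+ 2.
Proof. by move=> [y ->]; have [a [pa <- _ _]] := rc_abs y; exists a. Qed.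

(** With [v] the negative part of [y - x], the element [v(y^2 - x^2) = -v^2(y + x)] has both signs,
    so [v^2 y = v^2 x = 0]; this gives [v^3 = 0]. *)
Lemma pos_sqr_le x y : pos x -> pos y -> pos (y ^+ 2 - x ^+ 2) -> pos (y - x).
Proof.
move=> px py pd; have [u [v [pu pv uv e]]] := rc_decomp rcA (y - x).
suff v0 : v = 0 by rewrite e v0 subr0.
have e1 : v * (y ^+ 2 - x ^+ 2) = - (v ^+ 2 * (y + x)).
  have -> : v * (y ^+ 2 - x ^+ 2) = v * (y - x) * (y + x) by rng.
  rewrite e; have -> : v * (u - v) * (y + x) = (u * v - v ^+ 2) * (y + x) by rng.
  by rewrite uv sub0r mulNr.
have v2 : v ^+ 2 * y + v ^+ 2 * x = 0.
  rewrite -mulrDr; apply: (rc_anti rcA).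
    by apply: posM; [exact: pos_sqr|exact: (rc_posD rcA)].
  by rewrite -e1; exact: posM.
have p1 : pos (v ^+ 2 * y) by apply: posM => //; exact: pos_sqr.
have p2 : pos (v ^+ 2 * x) by apply: posM => //; exact: pos_sqr.
have vy := pos_sum0 p1 p2 v2.
have vx : v ^+ 2 * x = 0 by rewrite vy add0r in v2.
apply: (rc_reduced rcA (k := 3)).
have -> : v ^+ 3 = v * (u * v) - (v ^+ 2 * y - v ^+ 2 * x).
  by rewrite -mulrBr e; rng.
by rewrite uv vy vx mulr0 subrr subr0.
Qed.

(** * Radical ideals and their sums *)

Section Ideals.
Variable S : set A.
Hypotheses (SM : forall a x, S x -> S (a * x))
  (Srad : forall x, S (x ^+ 2) -> S x).

Lemma radical_convex a b : pos a -> pos (b - a) -> S b -> S a.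
Proof.
move=> pa pba Sb; have [c bc] := rc_convex rcA pa pba.
by apply: Srad; rewrite -bc mulrC; exact: SM.
Qed.

Lemma radical_abs x : S x -> exists a, [/\ S a, pos a & pos (a - x)].
Proof.
move=> Sx; have [a [pa ax ha _]] := rc_abs x; exists a; split=> //.
by apply: Srad; rewrite ax expr2; exact: SM.
Qed.

End Ideals.

Section SumIdeal.
Variables (S T : set A).
Hypotheses (SD : forall x y, S x -> S y -> S (x + y))
  (SM : forall a x, S x -> S (a * x)) (Srad : forall x, S (x ^+ 2) -> S x).
Hypotheses (TD : forall x y, T x -> T y -> T (x + y))
  (TM : forall a x, T x -> T (a * x)) (Trad : forall x, T (x ^+ 2) -> T x).

Let I : set A := [set x | exists b c, [/\ S b, T c & x = b + c]].

Lemma sum_idealD x y : I x -> I y -> I (x + y).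
Proof.
move=> [b [c [Sb Tc ->]]] [b' [c' [Sb' Tc' ->]]].
exists (b + b'), (c + c'); split; [exact: SD|exact: TD|].
by rewrite addrACA.
Qed.

Lemma sum_idealM a x : I x -> I (a * x).
Proof.
move=> [b [c [Sb Tc ->]]]; exists (a * b), (a * c).
by split; [exact: SM|exact: TM|rewrite mulrDr].
Qed.

(* Riesz decomposition *)
Lemma sum_convex a b : pos a -> pos (b - a) -> I b -> I a.
Proof.
move=> pa pba [s0 [t0 [Ss Tt be]]].
have [s [Ss' ps ss]] := radical_abs SM Srad Ss.
have [t [Tt' pt tt]] := radical_abs TM Trad Tt.
have past : pos (s + t - a).
  have -> : s + t - a = (s - s0) + (t - t0) + (b - a) by rewrite be; rng.
  by do 2 apply: (rc_posD rcA) => //.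
(* The summand [a - u] is the infimum of [a] and [s], hence below [s]; the remainder [u], the
   positive part of [a - s], is below [t]. *)
have [u [v [pu pv uv e]]] := rc_decomp rcA (a - s).
exists (a - u), u; split; last by rewrite subrK.
- apply: (@radical_convex S SM Srad _ s) => //.
    apply: (disjoint_pos pu pv uv); first by rewrite subrK.
    have -> : a - u + v = a - (u - v) by rng.
    by rewrite -e; have -> : a - (a - s) = s by rng.
  have -> : s - (a - u) = u - (a - s) by rng.
  by rewrite e; have -> : u - (u - v) = v by rng.
- apply: (@radical_convex T TM Trad _ t) => //.
  apply: (disjoint_pos pu pv uv); first by rewrite subrK.
  have -> : t - u + v = t - (u - v) by rng.
  by rewrite -e; have -> : t - (a - s) = s + t - a by rng.
Qed.

(** If [x^2 <= s + t] with [s] in [S] and [t] in [T] positive, then the absolute value of [x] is at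
    most the sum of the square roots of [s] and [t]. These roots lie in [S] and [T] by radicality,
    so convexity applies. *)
Lemma sum_radical x : I (x ^+ 2) -> I x.
Proof.
move=> [s0 [t0 [Ss Tt xe]]].
have [s [Ss' ps ss]] := radical_abs SM Srad Ss.
have [t [Tt' pt tt]] := radical_abs TM Trad Tt.
have [s1 ps1 se] := pos_root ps; have [t1 pt1 te] := pos_root pt.
have [a [pa ax pax pax']] := rc_abs x.
have Ist : I (s1 + t1).
  exists s1, t1; split=> //; first by apply: Srad; rewrite -se.
  by apply: Trad; rewrite -te.
have Ia : I a.
  apply: (sum_convex pa _ Ist).
  apply: pos_sqr_le => //; first exact: (rc_posD rcA).
  have -> : (s1 + t1) ^+ 2 - a ^+ 2 = (s - s0) + (t - t0) + (s1 * t1 + s1 * t1).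
    by rewrite ax xe se te; rng.
  by do ![apply: (rc_posD rcA) => //]; exact: posM.
(* Pass from the absolute value [a] to [x] itself, using that [a - x] lies between 0 and [2a]. *)
have Iax : I (a - x).
  apply: (@sum_convex _ (a + a)) => //; last exact: sum_idealD.
  by have -> : a + a - (a - x) = a + x by rng.
have -> : x = a + (-1) * (a - x) by rng.
by apply: sum_idealD => //; exact: sum_idealM.
Qed.

(** The disjoint parts of [x^2 - y^2] multiply to 0, so one of them lies in the prime [T]. Thus
    [x^2] and [y^2] are comparable modulo [T], and the fourth power of the smaller of [x], [y] is
    bounded by an element of the sum. *)
Lemma sum_prime x y : S 0 -> (forall x y, T (x * y) -> T x \/ T y) -> T 0 ->
  I (x * y) -> I x \/ I y.
Proof.
move=> S0 Tpr T0.
have TI z : T z -> I z by move=> Tz; exists 0, z; rewrite add0r.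
have half z w : I (z ^+ 2 * w ^+ 2) ->
    (exists u v, [/\ pos u, pos v, z ^+ 2 - w ^+ 2 = u - v & T v]) -> I w.
  move=> Izw [u [v [pu pv e Tv]]].
  apply: sum_radical; apply: sum_radical.
  apply: (@sum_convex _ (z ^+ 2 * w ^+ 2 + w ^+ 2 * v)); first exact: pos_sqr.
    have -> : z ^+ 2 * w ^+ 2 + w ^+ 2 * v - w ^+ 2 ^+ 2
      = w ^+ 2 * ((z ^+ 2 - w ^+ 2) + v) by rng.
    by rewrite e subrK; apply: posM => //; exact: pos_sqr.
  by apply: sum_idealD => //; apply: sum_idealM; exact: TI.
move=> Ixy; have Ixy2 : I (x ^+ 2 * y ^+ 2).
  by rewrite -exprMn expr2; exact: sum_idealM.
have [u [v [pu pv uv e]]] := rc_decomp rcA (x ^+ 2 - y ^+ 2).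
have [Tu|Tv] : T u \/ T v by apply: Tpr; rewrite uv.
  left; apply: (half y); first by rewrite mulrC.
  by exists v, u; split=> //; rewrite -opprB e opprB.
by right; apply: (half x) => //; exists u, v.
Qed.

End SumIdeal.

End Theory.

Lemma real_closed_ringE : real_closed_ring A <-> rc_axioms A.
Proof.
split=> [[red [le [fr lepos conv]] primes]|rcA].
  exact: (rc_axioms_of_f_ring fr lepos).
split; [exact: rc_reduced|exists (fun a b => pos (b - a))|exact: rc_prime].
split; [exact: rc_f_ring_order|by move=> a; rewrite subr0|].
by move=> a b; rewrite subr0; exact: rc_convex.
Qed.

End Order.

(** * Fibre products, local rings and minimal primes *)

Lemma rmorph_pos (A B : comNzRingType) (f : {rmorphism A -> B}) x :
  pos x -> pos (f x).
Proof. by move=> [y ->]; exists (f y); rewrite rmorphXn. Qed.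

Lemma domain_reduced (A : comNzRingType) : is_domain A ->
  forall (x : A) k, x ^+ k = 0 -> x = 0.
Proof.
move=> domA x; elim=> [|k IH].
  by rewrite expr0 => /eqP; rewrite oner_eq0.
by rewrite exprS => /domA [].
Qed.

Lemma domain_sqr_eq (A : comNzRingType) : is_domain A ->
  forall x y : A, x ^+ 2 = y ^+ 2 -> x = y \/ x + y = 0.
Proof.
move=> domA x y /eqP; rewrite -subr_eq0 subr_sqr => /eqP /domA [] /eqP.
  by rewrite subr_eq0 => /eqP; left.
by move=> /eqP; right.
Qed.

(** Positive elements lift to positive elements, but inequalities need not lift. Convexity in [A] is
    therefore applied to a lift [a] of the smaller element and to [a + b], where [b] is a positive
    lift of the difference. For antisymmetry [a + b] maps to 0, hence so does [a^2]. *)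
Lemma rc_axioms_onto (A B : comNzRingType) (f : {rmorphism A -> B}) :
  onto f -> is_domain B -> rc_axioms A -> rc_axioms B.
Proof.
move=> fo domB rcA.
have lift x : pos x -> exists2 a, pos a & x = f a.
  move=> [y ->]; have [a <-] := fo y; exists (a ^+ 2); first exact: pos_sqr.
  by rewrite rmorphXn.
split.
- exact: domain_reduced.
- move=> x y /lift [a pa ->] /lift [b pb ->].
  by rewrite -rmorphD; apply: rmorph_pos; exact: (rc_posD rcA).
- move=> x /lift [a pa ->] /lift [b pb fb].
  have fab : f (a + b) = 0 by rewrite rmorphD -fb subrr.
  have [|c cE] := @rc_convex _ rcA a (a + b) pa.
    by rewrite addrAC subrr add0r.
  apply: (@domain_reduced _ domB _ 2).
  by rewrite -rmorphXn -cE rmorphM fab mul0r.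
- move=> x; have [a <-] := fo x; have [u [v [pu pv uv ->]]] := rc_decomp rcA a.
  exists (f u), (f v); split; rewrite -?rmorphM -?rmorphB ?uv ?rmorph0 //.
    exact: rmorph_pos.
  exact: rmorph_pos.
- move=> x y /lift [a pa ->] /lift [b pb xy].
  have [|c cE] := @rc_convex _ rcA a (a + b) pa.
    by rewrite addrAC subrr add0r.
  exists (f c); rewrite -rmorphXn -cE rmorphM rmorphD -xy.
  by rewrite addrC subrK.
- move=> P; have [p pP] := prime_comap f P.
  exact/(real_closed_prime_onto fo pP)/(rc_prime rcA).
Qed.

Definition invertible (A : comNzRingType) (x : A) := exists y, x * y = 1.

Definition local_by_units (A : comNzRingType) :=
  forall a : A, invertible a \/ invertible (1 - a).

Lemma prime_not_invertible (A : comNzRingType) (p : prime_idealr A) x :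
  x \in p -> ~ invertible x.
Proof. by move=> px [y xy]; move: (idealr1 p); rewrite -xy idealMl. Qed.

(** The fibre product of [B] and [D] over [C] is described by its projections: jointly injective,
    and every compatible pair lifts. So [P] may be any ring isomorphic to it. *)
Section FibreProduct.
Variables (P B D C : comNzRingType).
Variables (alpha : {rmorphism P -> B}) (beta : {rmorphism P -> D}).
Variables (f : {rmorphism B -> C}) (g : {rmorphism D -> C}).
Hypotheses (fo : onto f) (go : onto g).
Hypothesis fg : forall x, f (alpha x) = g (beta x).
Hypothesis inj0 : forall x, alpha x = 0 -> beta x = 0 -> x = 0.
Hypothesis glue : forall b d, f b = g d ->
  exists2 x, alpha x = b & beta x = d.

Let pair_eq x y : alpha x = alpha y -> beta x = beta y -> x = y.
Proof.
move=> e1 e2; apply/eqP; rewrite -subr_eq0; apply/eqP.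
by apply: inj0; rewrite rmorphB ?e1 ?e2 subrr.
Qed.

Let alpha_onto : onto alpha.
Proof.
by move=> b; have [d gd] := go (f b); have [x] := glue (esym gd); exists x.
Qed.

Let beta_onto : onto beta.
Proof.
by move=> d; have [b fb] := fo (g d); have [x] := glue fb; exists x.
Qed.

Lemma fibre_rc : is_domain C -> rc_axioms B -> rc_axioms D -> rc_axioms P.
Proof.
move=> domC rcB rcD; have rcC := rc_axioms_onto fo domC rcB.
have pos_pair x : pos (alpha x) -> pos (beta x) -> pos x.
  move=> /(pos_root rcB) [s ps es] /(pos_root rcD) [t pt et].
  (* Positive roots agree in the domain [C] up to sign; if they are opposite, both are 0. *)
  have fgst : f s = g t.
    have := fg x; rewrite es et !rmorphXn => /(domain_sqr_eq domC) [//|st].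
    have pf := rmorph_pos f ps; have pg := rmorph_pos g pt.
    rewrite (pos_sum0 rcC pf pg st); rewrite addrC in st.
    by rewrite (pos_sum0 rcC pg pf st).
  have [y ys yt] := glue fgst; exists y.
  by apply: pair_eq; rewrite rmorphXn ?ys ?yt.
split.
- move=> x k xk; apply: inj0.
    by apply: (rc_reduced rcB (k := k)); rewrite -rmorphXn xk rmorph0.
  by apply: (rc_reduced rcD (k := k)); rewrite -rmorphXn xk rmorph0.
- move=> x y px py; apply: pos_pair; rewrite rmorphD.
    by apply: (rc_posD rcB); exact: rmorph_pos.
  by apply: (rc_posD rcD); exact: rmorph_pos.
- move=> x px pNx; apply: inj0.
    by apply: (rc_anti rcB); rewrite -?rmorphN; exact: rmorph_pos.
  by apply: (rc_anti rcD); rewrite -?rmorphN; exact: rmorph_pos.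
- move=> x.
  have [u [v [pu pv uv xB]]] := rc_decomp rcB (alpha x).
  have [u' [v' [pu' pv' uv' xD]]] := rc_decomp rcD (beta x).
  have [fu fv] : f u = g u' /\ f v = g v'.
    apply: (decomp_uniq rcC); try exact: rmorph_pos.
    - by rewrite -rmorphM uv rmorph0.
    - by rewrite -rmorphM uv' rmorph0.
    - by rewrite -!rmorphB -xB -xD fg.
  have [U Uu Uu'] := glue fu; have [V Vv Vv'] := glue fv.
  exists U, V; split.
  - by apply: pos_pair; rewrite ?Uu ?Uu'.
  - by apply: pos_pair; rewrite ?Vv ?Vv'.
  - by apply: inj0; rewrite rmorphM ?Uu ?Uu' ?Vv ?Vv'.
  - by apply: pair_eq; rewrite rmorphB ?Uu ?Uu' ?Vv ?Vv'.
- move=> a b pa pba.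
  have [||c [cE pc pac]] := @rc_convex_le B rcB (alpha a) (alpha b).
  + exact: rmorph_pos.
  + by rewrite -rmorphB; exact: rmorph_pos.
  have [||d [dE pd pad]] := @rc_convex_le D rcD (beta a) (beta b).
  + exact: rmorph_pos.
  + by rewrite -rmorphB; exact: rmorph_pos.
  (* If [f (alpha b)] is nonzero it can be cancelled. Otherwise [alpha a] and [beta a] map to 0 in
     [C], and so do [c] and [d], which lie between 0 and them; this is why quotients bounded by [a]
     were chosen. *)
  have fc : f c = g d.
    have [fb0|fb0] := pselect (f (alpha b) = 0).
      have fa0 : f (alpha a) = 0.
        apply: (@domain_reduced _ domC _ 2).
        by rewrite -rmorphXn -cE rmorphM fb0 mul0r.
      have [c' c'E] := rc_convex rcB pc pac.
      have [d' d'E] := rc_convex rcD pd pad.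
      transitivity (0 : C).
        apply: (@domain_reduced _ domC _ 2).
        by rewrite -rmorphXn -c'E rmorphM fa0 mul0r.
      apply/esym/(@domain_reduced _ domC _ 2).
      by rewrite -rmorphXn -d'E rmorphM -fg fa0 mul0r.
    have [|//|] := @domC (f (alpha b)) (f c - g d).
      rewrite mulrBr -rmorphM cE fg -rmorphM dE !rmorphXn fg.
      by rewrite subrr.
    by move=> /eqP; rewrite subr_eq0 => /eqP.
  have [z zc zd] := glue fc; exists z.
  by apply: pair_eq; rewrite rmorphM rmorphXn ?zc ?zd.
- move=> p.
  (* The kernels of [alpha] and [beta] have product 0, so [p] contains one of them and comes from a
     prime of [B] or of [D]. *)
  have [kp|/existsNP [x0 /not_implyP [x00 x0p]]] :=
      pselect (forall x, alpha x = 0 -> x \in p).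
    have [Q QE] := prime_image alpha_onto kp.
    apply/(real_closed_prime_onto alpha_onto (fun a => iff_sym (QE a))).
    exact: rc_prime.
  have kp y : beta y = 0 -> y \in p.
    move=> y0; have : x0 * y \in p.
      suff -> : x0 * y = 0 by exact: idealr0.
      by apply: inj0; rewrite rmorphM ?x00 ?y0 ?mul0r ?mulr0.
    by move=> /primeM [].
  have [Q QE] := prime_image beta_onto kp.
  apply/(real_closed_prime_onto beta_onto (fun a => iff_sym (QE a))).
  exact: rc_prime.
Qed.

(** If [z] lifts the inverse of [h x], then [1 - xz] maps to 0 and is not invertible; locality makes
    [xz] invertible. *)
Let lift_inv (A E : comNzRingType) (h : {rmorphism A -> E}) x :
  onto h -> local_by_units A -> invertible (h x) -> invertible x.
Proof.
move=> ho locA [y hxy]; have [z hz] := ho y.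
have [[w]|] := locA (x * z).
  by rewrite -mulrA => xw; exists (z * w).
move=> [w xzw]; have : h ((1 - x * z) * w) = 1 by rewrite xzw rmorph1.
rewrite rmorphM rmorphB rmorph1 rmorphM hz hxy subrr mul0r => /eqP.
by rewrite eq_sym oner_eq0.
Qed.

(** Invertibility of [alpha x] suffices for that of [x]: it passes to [C], lifts from there to
    [beta x] because [D] is local, and the two inverses agree in [C]. *)
Lemma fibre_local_by_units :
  local_by_units B -> local_by_units D -> local_by_units P.
Proof.
move=> locB locD.
have inv_alpha x : invertible (alpha x) -> invertible x.
  move=> ix.
  have [d xd] : invertible (beta x).
    apply: (lift_inv go locD); rewrite -fg.
    by have [y xy] := ix; exists (f y); rewrite -rmorphM xy rmorph1.
  have [b xb] := ix.
  have fbd : f b = g d.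
    rewrite -[f b]mulr1 -(rmorph1 g) -xd rmorphM -fg mulrA -rmorphM.
    by rewrite [b * _]mulrC xb rmorph1 mul1r.
  have [y yb yd] := glue fbd; exists y.
  by apply: pair_eq; rewrite rmorphM rmorph1 ?yb ?yd.
move=> x; have [ix|] := locB (alpha x); first by left; exact: inv_alpha.
by rewrite -(rmorph1 alpha) -rmorphB => /inv_alpha; right.
Qed.

End FibreProduct.

(** * Minimal primes and maximal ideals by Zorn's lemma *)

Lemma Zorn_above (T : Type) (Q : set (set T)) (X0 : set T) : Q X0 ->
  (forall F : set (set T), F !=set0 -> F `<=` Q -> total_on F subset ->
     Q (\bigcup_(X in F) X)) ->
  exists M, [/\ X0 `<=` M, Q M & forall B, Q B -> M `<=` B -> B `<=` M].
Proof.
move=> Q0 Qchain.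
(* Adjoining [X0] to every set settles the empty chain, whose union then stands for [X0]. *)
have [F FQ totF|M [QM Mmax]] := @Zorn_bigcup T [set X | Q (X0 `|` X)].
  have [[X FX]|F0] := pselect (F !=set0); last first.
    rewrite /= (_ : \bigcup_(X in F) X = set0) ?setU0 //.
    by rewrite bigcup0 // => X FX; case: F0; exists X.
  rewrite /= (_ : _ `|` _ = \bigcup_(Y in [set X0 `|` Z | Z in F]) Y).
    apply: Qchain; first by exists (X0 `|` X), X.
    - by move=> _ [Z FZ <-]; exact: FQ.
    - move=> _ _ [Z FZ <-] [W FW <-].
      by have [ZW|WZ] := totF _ _ FZ FW; [left|right]; exact: setUS.
  apply/seteqP; split=> x.
    move=> [X0x|[Y FY Yx]]; first by exists (X0 `|` X); [exists X|left].
    by exists (X0 `|` Y); [exists Y|right].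
  move=> [_ [Y FY <-] [X0x|Yx]]; first by left.
  by right; exists Y.
exists (X0 `|` M); split=> // B QB MB.
have [BM|BM] := pselect (B `<=` M).
  by move=> x /BM; right.
case: (Mmax B).
  by split=> // x Mx; apply: MB; right.
by rewrite /= (_ : X0 `|` B = B) //; apply/setUidPr => x X0x; apply: MB; left.
Qed.

(** The complement of a multiplicative set [S] that is maximal among those avoiding 0 is a minimal
    prime: a smaller prime would have a larger complement. Additivity comes from [SN], by which the
    elements outside [S] are those killed by some element of [S]. *)
Lemma minimal_prime_disjoint (A : comNzRingType) (S0 : set A) :
  (forall (x : A) k, x ^+ k = 0 -> x = 0) ->
  S0 1 -> (forall x y, S0 x -> S0 y -> S0 (x * y)) -> ~ S0 0 ->
  exists2 p : prime_idealr A, minimal_prime p & forall x, S0 x -> x \notin p.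
Proof.
move=> red S01 S0M S00.
pose Q := [set S : set A | [/\ S 1, forall x y, S x -> S y -> S (x * y) & ~ S 0]].
have [//|F [X FX] FQ totF|S [S0S [S1 SM Sn0] Smax]] := @Zorn_above A Q S0.
  split.
  - by exists X => //; have [] := FQ _ FX.
  - move=> x y [Y FY Yx] [Z FZ Zy]; have [YZ|ZY] := totF _ _ FY FZ.
      by exists Z => //; have [_ + _] := FQ _ FZ; apply => //; exact: YZ.
    by exists Y => //; have [_ + _] := FQ _ FY; apply => //; exact: ZY.
  - by move=> [Y FY Y0]; have [_ _] := FQ _ FY; apply.
have SN y : ~ S y -> exists2 s, S s & s * y = 0.
  move=> Sy; apply/not_exists2P => h; apply: Sy.
  (* If no element of [S] kills [y], adjoining the powers of [y] still avoids 0: [s y^k = 0] makes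
     [sy] nilpotent, hence 0. *)
  pose S' : set A := [set z | exists s k, S s /\ z = s * y ^+ k].
  apply: (Smax S'); last first.
  - by exists 1, 1%N; rewrite mul1r expr1.
  - by move=> s Ss; exists s, 0%N; rewrite mulr1.
  split.
  - by exists 1, 0%N; rewrite mulr1.
  - move=> _ _ [s [k [Ss ->]]] [t [l [St ->]]].
    by exists (s * t), (k + l)%N; rewrite mulrACA exprD; split=> //; exact: SM.
  - move=> [s [k [Ss sy]]]; have [//|] := h s.
    apply; apply: (red _ k.+1); rewrite exprMn [s ^+ _]exprSr [y ^+ _]exprS.
    have -> : s ^+ k * s * (y * y ^+ k) = s ^+ k * y * (s * y ^+ k).
      by rewrite -!mulrA; congr (_ * _); rewrite mulrCA.
    by rewrite -sy mulr0.
have [p pE] : exists p : prime_idealr A, forall x, (x \in p) <-> ~ S x.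
  apply: (@prime_idealr_of_set A (~` S)) => //=.
  - move=> x y /SN [s Ss sx] /SN [t St ty] Sxy; apply: Sn0.
    have -> : 0 = s * t * (x + y).
      by rewrite mulrDr mulrAC sx mul0r -mulrA ty mulr0 addr0.
    exact: SM (SM _ _ Ss St) Sxy.
  - move=> a x /SN [s Ss sx] Sax; apply: Sn0.
    have -> : 0 = s * (a * x) by rewrite mulrCA sx mulr0.
    exact: SM.
  - move=> x y Sxy; have [Sx|Sx] := pselect (S x); last by left.
    by right=> Sy; apply: Sxy; exact: SM.
exists p; last by move=> x S0x; apply/negP => /pE; apply; exact: S0S.
move=> q qp x /pE Sx; apply/negPn/negP => qx; apply: Sx.
apply: (Smax [set y | y \notin q]) => //=.
- split=> /=.
  + by rewrite idealr1.
  + by move=> y z qy qz; rewrite prime_idealrM negb_or qy.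
  + by rewrite idealr0.
- by move=> s Ss; apply/negP => /qp /pE.
Qed.

Lemma minimal_prime_avoid (A : comNzRingType) (x : A) :
  (forall (y : A) k, y ^+ k = 0 -> y = 0) -> x <> 0 ->
  exists2 r : prime_idealr A, minimal_prime r & x \notin r.
Proof.
move=> red x0.
have [||_ _ [k ->] [l ->]|[k xk]|r rmin rx] :=
    @minimal_prime_disjoint A [set y | exists k, y = x ^+ k].
- exact: red.
- by exists 0%N.
- by exists (k + l)%N; rewrite exprD.
- by apply: x0; apply: (red x k).
by exists r => //; apply: rx; exists 1%N; rewrite expr1.
Qed.

Lemma maximal_ideal_above (A : comNzRingType) (I : idealr A) :
  exists2 m : idealr A, maximal_ideal m & {subset I <= m}.
Proof.
pose Q := [set S : set A | [/\ S 0, ~ S 1, forall x y, S x -> S y -> S (x + y)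
  & forall a x, S x -> S (a * x)]].
have QI (J : idealr A) : Q [set` J].
  split=> /=; rewrite ?idealr0 ?idealr1 //.
    by move=> x y; exact: rpredD.
  by move=> a x; exact: idealMr.
have [//|F [X FX] FQ totF|M [IM [M0 M1 MD MM] Mmax]] := @Zorn_above A Q [set` I].
  split.
  - by exists X => //; have [] := FQ _ FX.
  - by move=> [Y FY Y1]; have [_ + _ _] := FQ _ FY; apply.
  - move=> x y [Y FY Yx] [Z FZ Zy]; have [YZ|ZY] := totF _ _ FY FZ.
      by exists Z => //; have [_ _ + _] := FQ _ FZ; apply => //; exact: YZ.
    by exists Y => //; have [_ _ + _] := FQ _ FY; apply => //; exact: ZY.
  - by move=> a x [Y FY Yx]; exists Y => //; have [_ _ _] := FQ _ FY; apply.
have [m mE] := idealr_of_set M0 M1 MD MM.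
exists m; last by move=> x Ix; apply/mE/IM.
by move=> J mJ x Jx; apply/mE; apply: (Mmax [set` J]) => // y /mE; exact: mJ.
Qed.

(** For a local ring, non-units lie in the maximal ideal, which cannot contain both [a] and [1 - a].
    Conversely non-units are closed under addition: if [(x + y)z = 1], then [xz] or [1 - xz = yz] is
    invertible. *)
Lemma local_ringP (A : comNzRingType) : local_ring A <-> local_by_units A.
Proof.
split=> [[m mmax muniq] a|locA].
  have nonunit x : ~ invertible x -> x \in m.
    move=> ux.
    have [||y z [b ->] [c ->]|b y [c ->]|I IE] :=
        @idealr_of_set A [set y | exists b, y = b * x].
    - by exists 0; rewrite mul0r.
    - by move=> [b bx]; apply: ux; exists b; rewrite mulrC.
    - by exists (b + c); rewrite mulrDl.
    - by exists (b * c); rewrite mulrA.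
    have [m' m'max Im'] := maximal_ideal_above I.
    by rewrite -(muniq _ m'max); apply/Im'/IE; exists 1; rewrite mul1r.
  apply/or_asboolP; apply/negPn/negP; rewrite negb_or.
  move=> /andP[/asboolPn ua /asboolPn ub].
  by move: (idealr1 m); rewrite -(subrK a 1) rpredD ?nonunit.
have [||x y ux uy [z zE]|a x ux [z zE]|m mE] :=
    @idealr_of_set A [set x | ~ invertible x].
- by move=> [y]; rewrite mul0r => /eqP; rewrite eq_sym oner_eq0.
- by apply; exists 1; rewrite mulr1.
- have [[w wE]|[w wE]] := locA (x * z).
    by apply: ux; exists (z * w); rewrite mulrA.
  apply: uy; exists (z * w); rewrite mulrA -[RHS]wE -zE [(x + y) * z]mulrDl.
  by rewrite addrAC subrr add0r.
- by apply: ux; exists (a * z); rewrite mulrA [x * a]mulrC.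
have sub_m (I : idealr A) : {subset I <= m}.
  by move=> x Ix; apply/mE => -[y xy]; move: (idealr1 I); rewrite -xy idealMl.
exists m; first by move=> I _.
by move=> m' m'max x; apply/idP/idP; [exact: sub_m|exact: m'max].
Qed.

Lemma valuation_ring_local_by_units (A : comNzRingType) :
  valuation_ring A -> local_by_units A.
Proof.
move=> [_ cmp] a; have [[c e]|[c e]] := cmp a (1 - a).
  by left; exists (1 + c); rewrite mulrDr mulr1 -e addrC subrK.
by right; exists (1 + c); rewrite mulrDr mulr1 -e subrK.
Qed.

(** * Finite products and families of primes *)

Lemma rprod_ext (A_ : nat -> comNzRingType) j (x y : rprod A_ j.+1) :
  proj (leqnSn j) x = proj (leqnSn j) y -> x ord_max = y ord_max -> x = y.
Proof.
move=> exy emax; apply: functional_extensionality_dep => i.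
have [lt_ij|le_ji] := ltnP i j.
  have -> : i = widen_ord (leqnSn j) (Ordinal lt_ij) by exact: val_inj.
  exact: (congr1 (fun z : rprod A_ j => z (Ordinal lt_ij)) exy).
suff -> : i = ord_max by [].
by apply: val_inj; apply/eqP; rewrite eqn_leq /= le_ji -ltnS ltn_ord.
Qed.

Lemma ex_rcons (A_ : nat -> comNzRingType) j (x : rprod A_ j) (y : A_ j) :
  exists2 z : rprod A_ j.+1, proj (leqnSn j) z = x & z ord_max = y.
Proof.
(* The default 0 occurs only at index [j], where [dfwith] overwrites it by [y]. *)
pose f (i : 'I_j.+1) : A_ i :=
  if pselect (i < j)%N is left lt_ij then x (Ordinal lt_ij) else 0.
exists (@dfwith 'I_j.+1 (fun i : 'I_j.+1 => A_ i) f ord_max y); last first.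
  by rewrite dfwith_in.
apply: functional_extensionality_dep => -[i lt_i].
rewrite /proj dfwith_out; last by rewrite -val_eqE /= neq_ltn lt_i orbT.
rewrite /f; case: pselect => [lt_ij|]; last by case; exact: lt_i.
by rewrite (bool_irrelevance lt_ij lt_i).
Qed.

Section Coord.
Variables (A : comNzRingType) (A_ : nat -> comNzRingType) (n : nat).
Variables (eps : {rmorphism A -> rprod A_ n}) (i : 'I_n).

Definition rprod_coord (a : A) : A_ i := eps a i.

Fact rprod_coord_zmod : zmod_morphism rprod_coord.
Proof. by move=> a b; rewrite /rprod_coord rmorphB. Qed.
Fact rprod_coord_monoid : monoid_morphism rprod_coord.
Proof. by split=> [|a b]; rewrite /rprod_coord ?rmorph1 ?rmorphM. Qed.

HB.instance Definition _ :=
  GRing.isZmodMorphism.Build A (A_ i) rprod_coord rprod_coord_zmod.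
HB.instance Definition _ :=
  GRing.isMonoidMorphism.Build A (A_ i) rprod_coord rprod_coord_monoid.

End Coord.

Lemma prime_ker (A B : comNzRingType) (f : {rmorphism A -> B}) :
  is_domain B -> exists p : prime_idealr A, forall a, (a \in p) <-> f a = 0.
Proof.
move=> domB; apply: (@prime_idealr_of_set A [set a | f a = 0]) => /=.
- exact: rmorph0.
- by rewrite rmorph1; apply/eqP; exact: oner_neq0.
- by move=> x y; rewrite rmorphD => -> ->; rewrite addr0.
- by move=> a x; rewrite rmorphM => ->; rewrite mulr0.
- by move=> x y; rewrite rmorphM; exact: domB.
Qed.

(** If every [p i] had an element outside [r], the product of these elements would lie in all [p i],
    hence be 0, and yet lie outside the prime [r]. *)
Lemma prime_above_family (A : comNzRingType) (p : nat -> prime_idealr A) n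
    (r : prime_idealr A) :
  (forall a, (forall i, (i < n)%N -> a \in p i) -> a = 0) ->
  exists2 i, (i < n)%N & {subset p i <= r}.
Proof.
move=> cap0; apply: contrapT => nosub.
suff [y ry py] : exists2 y, y \notin r & forall i, (i < n)%N -> y \in p i.
  by move: ry; rewrite (cap0 y py) idealr0.
suff H k : (k <= n)%N ->
    exists2 y, y \notin r & forall i, (i < k)%N -> y \in p i by exact: H.
elim: k => [_|k IH lt_kn]; first by exists 1; rewrite ?idealr1.
have [y ry py] := IH (ltnW lt_kn).
have [x px rx] : exists2 x, x \in p k & x \notin r.
  apply: contrapT => nox; apply: nosub; exists k => // x px.
  by apply: contrapT => /negP rx; apply: nox; exists x.
exists (y * x); first by rewrite prime_idealrM negb_or ry.
move=> i; rewrite ltnS leq_eqVlt => /predU1P[->|lt_ik]; first exact: idealMr.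
by apply: idealMl; exact: py.
Qed.

Lemma minimal_prime_in_family (A : comNzRingType) (p : nat -> prime_idealr A) n
    (r : prime_idealr A) :
  (forall a, (forall i, (i < n)%N -> a \in p i) -> a = 0) ->
  minimal_prime r -> exists2 i, (i < n)%N & r = p i.
Proof.
move=> cap0 rmin; have [i lt_in pr] := prime_above_family r cap0.
exists i => //; apply: prime_idealr_ext => x.
by apply/idP/idP; [exact: rmin|exact: pr].
Qed.

Lemma subdirect_SV (A : comNzRingType) n : (0 < n)%N ->
  local_rc_subdirect A n -> local_rc_SV_rank_at_most A n.
Proof.
move=> n0 [locA rcA [A_ [eps [A_val eps_inj eps_onto]]]].
have ker_ex i : exists p : prime_idealr A, forall (lt_in : (i < n)%N) a,
    (a \in p) <-> eps a (Ordinal lt_in) = 0.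
  have [lt_in|] := pselect (i < n)%N.
    have [|p pE] := @prime_ker A _ (rprod_coord eps (Ordinal lt_in)).
      by have [_ []] := A_val _ lt_in.
    by exists p => lt_in' a; rewrite pE (bool_irrelevance lt_in' lt_in).
  (* Beyond [n] the kernel of coordinate 0 serves as a filler. *)
  have [|p _] := @prime_ker A _ (rprod_coord eps (Ordinal n0)).
    by have [_ []] := A_val _ n0.
  by exists p.
have [p pE] := choice ker_ex.
have cap0 a : (forall i, (i < n)%N -> a \in p i) -> a = 0.
  move=> pa; apply: eps_inj; rewrite rmorph0.
  apply: functional_extensionality_dep => -[i lt_in].
  exact/pE/pa.
split=> //.
  move=> r; split; first exact: quot_domain.
  have [i lt_in pr] := prime_above_family r cap0.
  have [_ [_ cmp] _] := A_val _ lt_in.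
  (* Divisibility in [A_ i] passes to [A/r]: the coordinate map is onto, and its kernel [p i] lies
     in [r]. *)
  have lift x y (z : A_ i) : eps x (Ordinal lt_in) = eps y (Ordinal lt_in) * z ->
      exists c, quot_map r x = quot_map r y * c.
    move=> exy.
    have [c _ cE] : range (fun a => eps a (Ordinal lt_in)) z by rewrite eps_onto.
    exists (quot_map r c); rewrite -rmorphM; apply/quot_map_eq/pr/(pE _ lt_in).
    by rewrite rmorphB rmorphM -[LHS]/(_ - _ * _) exy /= cE subrr.
  move=> x y; have [a <-] := onto_quot_map x; have [b <-] := onto_quot_map y.
  have [[c e]|[c e]] := cmp (eps a (Ordinal lt_in)) (eps b (Ordinal lt_in)).
    by left; exact: lift e.
  by right; exact: lift e.
apply: (@card_le_trans _ _ _ (p @` `I_n)); last exact: card_image_le.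
apply: subset_card_le => r /= rmin.
by have [i lt_in ->] := minimal_prime_in_family cap0 rmin; exists i.
Qed.

(** If [A/p] is a field, everything outside [p] is invertible by locality, so [p] contains every
    prime. By minimality it is then the only minimal prime, hence 0 by reducedness, and [A] is a
    field. *)
Lemma local_minimal_prime_not_field (A : comNzRingType)
    (p : prime_idealr A) :
  (forall (x : A) k, x ^+ k = 0 -> x = 0) -> local_by_units A -> ~ is_field A ->
  minimal_prime p -> ~ is_field {ideal_quot p}.
Proof.
move=> red locA nfA pmin pfield.
have inv x : x \notin p -> invertible x.
  move=> px; have [|y] := pfield (quot_map p x).
    by apply/eqP => /quot_map_eq0; apply/negP.
  have [z <-] := onto_quot_map y; rewrite -rmorphM -(rmorph1 (quot_map p)).
  move=> /quot_map_eq pxz.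
  have [[w]|[w ww]] := locA (x * z).
    by rewrite -mulrA => xzw; exists (z * w).
  by case: (prime_not_invertible pxz); exists (- w); rewrite mulrN -mulNr opprB.
have p0 x : x \in p -> x = 0.
  move=> px; apply: contrapT => x0.
  have [r rmin rx] := minimal_prime_avoid red x0.
  have rp : {subset r <= p}.
    move=> y ry; apply: contrapT => /negP /inv; exact: prime_not_invertible ry.
  by move/negP: rx; apply; exact: pmin px.
apply: nfA => x /eqP x0; apply: inv; apply/negP => /p0; exact: x0.
Qed.

Lemma minimal_prime_enum (A : comNzRingType) n :
  (forall (x : A) k, x ^+ k = 0 -> x = 0) -> rank_at_most A n ->
  exists p : nat -> prime_idealr A,
    (forall i, minimal_prime (p i)) /\
    forall a, (forall i, (i < n)%N -> a \in p i) -> a = 0.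
Proof.
move=> red /pcard_leP [f].
have [r0 r0min _] : exists2 r : prime_idealr A, minimal_prime r & 1 \notin r.
  by apply: minimal_prime_avoid => //; apply/eqP; exact: oner_neq0.
(* The injection [f] into the indices below [n] is inverted on its image; elsewhere [r0] fills in,
   which causes repetitions. *)
have /choice [p pP] : forall i : nat, exists r : prime_idealr A, minimal_prime r /\
    forall r', minimal_prime r' -> f r' = i -> r' = r.
  move=> i.
  have [[r rmin fr]|nor] := pselect (exists2 r, minimal_prime r & f r = i).
    exists r; split=> // r' r'min fr'.
    by apply: (@inj _ _ _ f); rewrite ?inE //= fr.
  by exists r0; split=> // r' r'min fr'; case: nor; exists r'.
exists p; split=> [i|a pa]; first by have [] := pP i.
apply: contrapT => /(minimal_prime_avoid red) [r rmin /negP]; apply.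
have [_ /(_ _ rmin erefl) ->] := pP (f r).
apply: pa; exact: (@funS _ _ _ _ f).
Qed.

(** * Fibre products of quotients *)

Lemma sum_prime_idealr (A : comNzRingType) (p : nat -> prime_idealr A) j :
  rc_axioms A -> local_by_units A -> (0 < j)%N ->
  exists q : prime_idealr A, forall a, (a \in q) <->
    exists b c : A, [/\ forall i, (i < j)%N -> b \in p i, c \in p j & a = b + c].
Proof.
move=> rcA locA j0.
pose S : set A := [set b | forall i, (i < j)%N -> b \in p i].
pose T : set A := [set` p j].
have SD x y : S x -> S y -> S (x + y).
  by move=> Sx Sy i lt_ij; rewrite rpredD ?Sx ?Sy.
have SM a x : S x -> S (a * x) by move=> Sx i lt_ij; rewrite idealMr ?Sx.
have Srad x : S (x ^+ 2) -> S x.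
  by move=> Sx i lt_ij; apply: (@primeX _ _ _ 2); exact: Sx.
have S0 : S 0 by move=> i lt_ij; exact: idealr0.
have TD x y : T x -> T y -> T (x + y) by exact: rpredD.
have TM a x : T x -> T (a * x) by exact: idealMr.
have Trad x : T (x ^+ 2) -> T x by exact: primeX.
have T0 : T 0 by exact: idealr0.
apply: prime_idealr_of_set.
- by exists 0, 0; split=> //; rewrite addr0.
(* Properness is where locality enters: if [1 = b + c], one of [b], [c] is invertible. *)
- move=> [b [c [Sb Tc e]]].
  have [ib|ic] := locA b; first exact: (prime_not_invertible (Sb 0%N j0)).
  by apply: (prime_not_invertible Tc); rewrite e addrAC subrr add0r in ic.
- exact: (sum_idealD SD TD).
- exact: (sum_idealM SM TM).
- move=> x y; apply: (sum_prime rcA SD SM Srad TD TM Trad) => //.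
  by move=> ? ?; exact: primeM.
Qed.

Section Diag.
Variables (A : comNzRingType) (p q : nat -> prime_idealr A) (n : nat).
Hypothesis qE : forall j, (0 < j < n)%N -> forall a : A, a \in q j <->
  exists b c : A, [/\ forall i, (i < j)%N -> b \in p i, c \in p j & a = b + c].

Lemma left_sub_q j : (0 < j < n)%N ->
  forall b, (forall i : 'I_j, b \in p i) -> b \in q j.
Proof.
move=> jn b pb; apply/(qE jn); exists b, 0.
rewrite idealr0 addr0; split=> // i lt_ij; exact: (pb (Ordinal lt_ij)).
Qed.

Lemma right_sub_q j : (0 < j < n)%N -> {subset p j <= q j}.
Proof.
move=> jn b pb; apply/(qE jn); exists 0, b.
by rewrite add0r; split=> // i _; exact: idealr0.
Qed.

Lemma diag_eq j (a b : A) : (forall i, (i < j)%N -> a - b \in p i) ->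
  @diag A p j a = @diag A p j b.
Proof.
move=> ab; apply: functional_extensionality_dep => -[i lt_ij].
exact/quot_map_eq/ab.
Qed.

(** Writing [a - b = c + d] with [c] in the earlier primes and [d] in [p j], the element
    [a - c = b + d] lifts both [a] and [b]. *)
Lemma diag_glue j (a : A) (x : rprod (quot_family p) j.+1) (b : A) :
  (0 < j < n)%N -> @diag A p j a = proj (leqnSn j) x ->
  x ord_max = quot_map (p j) b -> a - b \in q j ->
  exists c, @diag A p j.+1 c = x.
Proof.
move=> jn ax bx /(qE jn) [c [d [pc pd abcd]]].
exists (a - c); apply: rprod_ext.
  rewrite -ax; apply: diag_eq => i lt_ij.
  by rewrite addrAC subrr add0r rpredN pc.
rewrite bx; apply/quot_map_eq.
have -> : a - c - b = d by rewrite addrAC abcd addrAC subrr add0r.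
exact: pd.
Qed.

Lemma range_diag j : (0 < j)%N -> (j <= n)%N ->
  range (@diag A p j) = @iterated_fibre A p q j.
Proof.
case: j => // j _; elim: j => [_|j IH lt_jn].
  apply/seteqP; split=> // x _; exists (repr (x ord0 : {ideal_quot p 0})) => //.
  by apply: functional_extensionality_dep => i; rewrite (ord1 i); exact: reprK.
have jn : (0 < j.+1 < n)%N by [].
have {}IH := IH (ltnW lt_jn).
apply/seteqP; split=> x.
  move=> [a _ <-].
  have ha : @iterated_fibre A p q j.+1 (@diag A p j.+1 a) by rewrite -IH; exists a.
  exists (SigSub (mem_set ha)) => //=.
  rewrite quot_leftE; last exact: left_sub_q.
  by rewrite quot_rightE //; exact: right_sub_q.
move=> [s sx].
have [a _ as_] : range (@diag A p j.+1) (val s).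
  by rewrite IH; exact: set_mem (valP s).
 rewrite -as_ quot_leftE; last exact: left_sub_q.
have [b bx] := onto_quot_map (x ord_max : {ideal_quot p j.+1}).
rewrite -bx quot_rightE; last exact: right_sub_q.
move=> /quot_map_eq ab.
have [c cx] := diag_glue jn (etrans as_ sx) (esym bx) ab.
by exists c.
Qed.

End Diag.

Lemma SV_prime_fibre (A : comNzRingType) n : (2 <= n)%N -> ~ is_field A ->
  local_rc_SV_rank_at_most A n ->
  exists p q : nat -> prime_idealr A, prime_fibre_decomposition p q n.
Proof.
move=> le2n nfA [/local_ringP locA /real_closed_ringE rcA svA rkA].
have red := rc_reduced rcA.
have [p [pmin cap0]] := minimal_prime_enum red rkA.
have /choice [q qE] : forall j : nat, exists q : prime_idealr A,
    (0 < j)%N -> forall a, (a \in q) <->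
    exists b c : A, [/\ forall i, (i < j)%N -> b \in p i, c \in p j & a = b + c].
  case=> [|j]; first by exists (p 0).
  by have [q qE] := sum_prime_idealr p rcA locA (ltn0Sn j); exists q.
have qE' j : (0 < j < n)%N -> forall a : A, a \in q j <->
    exists b c : A, [/\ forall i, (i < j)%N -> b \in p i, c \in p j & a = b + c].
  by move=> /andP[j0 _]; exact: qE.
exists p, q; split=> //.
- move=> i _; split; [|exact: svA|exact: local_minimal_prime_not_field].
  apply/real_closed_ringE; apply: (rc_axioms_onto (onto_quot_map (p := p i))) => //.
  exact: quot_domain.
- split; last by apply: (range_diag qE') => //; exact: ltnW.
  move=> a b eqab; apply/eqP; rewrite -subr_eq0; apply/eqP/cap0 => i lt_in.
  apply/quot_map_eq.
  exact: (congr1 (fun x : rprod (quot_family p) n => x (Ordinal lt_in)) eqab).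
Qed.

Lemma im_ring_map (A R : comNzRingType) (f : {rmorphism A -> R}) :
  exists2 h : {rmorphism A -> im_ring f}, onto h & forall a, \val (h a) = f a.
Proof.
have fa a : range f (f a) by exists a.
pose h a : im_ring f := SigSub (mem_set (fa a)).
have hB : zmod_morphism h.
  by move=> a b; apply: val_inj; rewrite [RHS]rmorphB /= rmorphB.
have hM : monoid_morphism h.
  split=> [|a b]; apply: val_inj; first by rewrite [RHS]rmorph1 /= rmorph1.
  by rewrite [RHS]rmorphM /= rmorphM.
pose hh : {rmorphism A -> im_ring f} := HB.pack h
  (GRing.isZmodMorphism.Build A (im_ring f) h hB)
  (GRing.isMonoidMorphism.Build A (im_ring f) h hM).
exists hh => // y; have [a _ ay] : range f (\val y) by exact: set_mem (valP y).
by exists a; apply: val_inj.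
Qed.

(** The prime [q j.+1] contains the kernels of the maps from [A] to the stage before and to
    [A / p j.+1]. Its images there are [I] and [J], and [theta] identifies the two quotients with
    [A / q j.+1]. *)
Lemma prime_fibre_iterated (A : comNzRingType) n (le2n : (2 <= n)%N)
    (p q : nat -> prime_idealr A) :
  prime_fibre_decomposition p q n -> iterated_fibre_embedding A le2n.
Proof.
move=> [cap0 qE p_val [diag_inj _]].
exists (quot_family p), (@diag A p n); split=> //.
  apply/seteqP; split=> // x _; exists (repr (x ord0 : {ideal_quot p 0})) => //.
  by apply: functional_extensionality_dep => i; rewrite (ord1 i); exact: reprK.
move=> j lt_jn; have jn : (0 < j.+1 < n)%N by [].
have [h ho hE] := im_ring_map
  (proj (ltnW lt_jn) \o @diag A p n : {rmorphism A -> rprod (quot_family p) j.+1}).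
have [|I IE] := @prime_image _ _ h (q j.+1) ho.
  move=> a ha0; apply: (left_sub_q qE) => // i; apply/quot_map_eq0.
  have := hE a; rewrite ha0.
  by move=> /(congr1 (fun x : rprod (quot_family p) j.+1 => x i)) /esym.
have [|J JE] := @prime_image _ _ (quot_map (p j.+1)) (q j.+1) (@onto_quot_map _ _).
  by move=> a /quot_map_eq0; apply: (right_sub_q qE).
have [a|theta [theta_bij thetaE]] :=
    @quot_iso A _ _ h (quot_map (p j.+1)) I J ho (@onto_quot_map _ _).
  by rewrite IE JE.
exists I, J, theta; split=> //; apply/seteqP; split=> x.
  by move=> [a _ <-]; exists (h a); [exact: hE|exact: thetaE].
move=> [s sx]; have [a as_] := ho s.
have [b bx] := onto_quot_map (x ord_max : {ideal_quot p j.+1}).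
rewrite -as_ -bx => thE; have {}thE := etrans (esym (thetaE a)) thE.
move/quot_map_eq: thE; rewrite -rmorphB => /JE ab.
have [|c cx] := diag_glue qE jn (etrans _ sx) (esym bx) ab.
  by rewrite -as_; exact: (esym (hE a)).
by exists c.
Qed.

(** * Iterated fibre products *)

Lemma local_by_units_onto (A B : comNzRingType) (f : {rmorphism A -> B}) :
  onto f -> local_by_units A -> local_by_units B.
Proof.
have finv x : invertible x -> invertible (f x).
  by move=> [y xy]; exists (f y); rewrite -rmorphM xy rmorph1.
move=> fo locA b; have [a <-] := fo b; have [ia|ia] := locA a.
  by left; exact: finv.
by right; rewrite -(rmorph1 f) -rmorphB; exact: finv.
Qed.

Lemma rprod_Ordinal (A_ : nat -> comNzRingType) n (x : rprod A_ n) i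
    (h h' : (i < n)%N) : x (Ordinal h) = x (Ordinal h').
Proof. by rewrite (bool_irrelevance h h'). Qed.

Section IteratedFibre.
Variables (A : comNzRingType) (A_ : nat -> comNzRingType) (n : nat).
Variable eps : {rmorphism A -> rprod A_ n}.
Hypothesis A_val : forall i, (i < n)%N -> nontrivial_rcvr (A_ i).

(** Any surjection [phi] with the kernel of the projection to coordinates 0 to [j + 1] is allowed,
    so the step serves both the next image ring and, at the last stage, [A] itself. *)
Lemma iterated_step j (lt_jn : (j.+1 < n)%N)
    (I : prime_idealr (im_proj eps (ltnW lt_jn))) (J : prime_idealr (A_ j.+1))
    (theta : {rmorphism {ideal_quot I} -> {ideal_quot J}})
    (P : comNzRingType) (phi : {rmorphism A -> P}) :
  bijective theta ->
  range (proj lt_jn \o eps) =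
    fibre_product (S := range (proj (ltnW lt_jn) \o eps))
      (fun s : im_proj eps (ltnW lt_jn) => theta (\pi_{ideal_quot I} s))
      (fun y : A_ j.+1 => \pi_{ideal_quot J} y) ->
  onto phi -> (forall a, phi a = 0 <-> proj lt_jn (eps a) = 0) ->
  rc_axioms (im_proj eps (ltnW lt_jn)) ->
  local_by_units (im_proj eps (ltnW lt_jn)) ->
  rc_axioms P /\ local_by_units P.
Proof.
move=> [theta' thetaK theta'K] fibE phio kerphi rcB locB.
have [/real_closed_ringE rcD valD _] := A_val lt_jn.
have locD := valuation_ring_local_by_units valD.
have [h ho hE] := im_ring_map
  (proj (ltnW lt_jn) \o eps : {rmorphism A -> rprod A_ j.+1}).
pose k : {rmorphism A -> A_ j.+1} :=
  (rprod_coord eps (Ordinal lt_jn) : {rmorphism A -> A_ (Ordinal lt_jn)}).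
have kE a : k a = proj lt_jn (eps a) ord_max by exact: rprod_Ordinal.
have hE' a : \val (h a) = proj (leqnSn j.+1) (proj lt_jn (eps a)).
  rewrite hE; apply: functional_extensionality_dep => i.
  exact: rprod_Ordinal.
have [|alpha alphaE] := @rmorph_factor _ _ _ phi h phio.
  by move=> a /kerphi a0; apply: val_inj; rewrite hE' a0.
have [|beta betaE] := @rmorph_factor _ _ _ phi k phio.
  by move=> a /kerphi a0; rewrite kE a0.
pose f : {rmorphism im_proj eps (ltnW lt_jn) -> {ideal_quot J}} :=
  theta \o quot_map I.
have fo : onto f.
  apply: onto_comp; first exact: onto_quot_map.
  by move=> y; exists (theta' y).
have fg x : f (alpha x) = quot_map J (beta x).
  have [a <-] := phio x; rewrite alphaE betaE.
  have : range (proj lt_jn \o eps) (proj lt_jn (eps a)) by exists a.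
  rewrite fibE => -[s sE fs]; rewrite kE; apply: etrans fs.
  suff -> : h a = s by [].
  by apply: val_inj; rewrite hE'.
have inj0 x : alpha x = 0 -> beta x = 0 -> x = 0.
  have [a <-] := phio x; rewrite alphaE betaE => ha0 ka0; apply/kerphi.
  by apply: rprod_ext; rewrite -?hE' -?kE ?ha0 ?ka0.
have glue b d : f b = quot_map J d -> exists2 x, alpha x = b & beta x = d.
  move=> fbd; have [z zb zd] := ex_rcons (\val b) d.
  have : range (proj lt_jn \o eps) z by rewrite fibE; exists b => //; rewrite zd.
  move=> [a _ az]; exists (phi a).
    by rewrite alphaE; apply: val_inj; rewrite hE' -zb -az.
  by rewrite betaE kE -zd -az.
have go := @onto_quot_map _ J; have dJ := @quot_domain _ J.
split; first exact: (fibre_rc fo go fg inj0 glue).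
exact: (fibre_local_by_units go fg inj0 glue).
Qed.

(** A one-factor product is its factor: the image ring and [A_ 0] are quotients of [A] by the same
    kernel. *)
Lemma im_proj0 (lt_0n : (0 < n)%N) :
  range (proj lt_0n \o eps) = [set: rprod A_ 1] ->
  onto (rprod_coord eps (Ordinal lt_0n)) /\
  (rc_axioms (im_proj eps lt_0n) /\ local_by_units (im_proj eps lt_0n)).
Proof.
move=> base.
have [/real_closed_ringE rcD valD _] := A_val lt_0n.
have cE a : rprod_coord eps (Ordinal lt_0n) a = (proj lt_0n \o eps) a ord_max.
  exact: rprod_Ordinal.
have co : onto (rprod_coord eps (Ordinal lt_0n)).
  move=> y; have [z _ zy] := ex_rcons (0 : rprod A_ 0) y.
  have [a _ az] : range (proj lt_0n \o eps) z by rewrite base.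
  by exists a; rewrite cE az.
split=> //.
have [h ho hE] := im_ring_map (proj lt_0n \o eps : {rmorphism A -> rprod A_ 1}).
have ker a : h a = 0 <-> rprod_coord eps (Ordinal lt_0n) a = 0.
  split=> [ha0|ca0].
    by rewrite cE -hE ha0.
  apply: val_inj; rewrite hE; apply: rprod_ext; last exact: etrans (esym (cE a)) ca0.
  by apply: functional_extensionality_dep => -[].
have [|g gE] := @rmorph_factor _ _ _ (rprod_coord eps (Ordinal lt_0n)) h co.
  by move=> a /ker.
have go : onto g.
  move=> y; have [a <-] := ho y.
  by exists (rprod_coord eps (Ordinal lt_0n) a); exact: gE.
split; last exact: (local_by_units_onto go (valuation_ring_local_by_units valD)).
apply: (rc_axioms_onto go _ rcD) => x y; have [a <-] := ho x; have [b <-] := ho y.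
rewrite -rmorphM => /ker; rewrite rmorphM => /(proj1 valD) [] /ker.
  by left.
by right.
Qed.

End IteratedFibre.

Lemma iterated_subdirect (A : comNzRingType) n (le2n : (2 <= n)%N) :
  iterated_fibre_embedding A le2n -> local_rc_subdirect A n.
Proof.
move=> [A_ [eps [A_val eps_inj base step]]].
have [co0 rcloc0] := im_proj0 A_val base.
have rcloc j : forall lt_jn : (j < n)%N,
    rc_axioms (im_proj eps lt_jn) /\ local_by_units (im_proj eps lt_jn).
  elim: j => [|j IH] lt_jn; first by rewrite (bool_irrelevance lt_jn (ltnW le2n)).
  have [I [J [theta [theta_bij fibE]]]] := step j lt_jn.
  have [rcB locB] := IH (ltnW lt_jn).
  have [h ho hE] := im_ring_map (proj lt_jn \o eps : {rmorphism A -> rprod A_ j.+2}).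
  apply: (iterated_step A_val theta_bij fibE ho _ rcB locB) => a.
  split=> [ha0|pa0]; first by rewrite -[LHS]/((proj lt_jn \o eps) a) -hE ha0.
  by apply: val_inj; rewrite hE.
have [rcA locA] : rc_axioms A /\ local_by_units A.
  (* The last step has [j = n - 2] and projects to all [n] coordinates, so its kernel is that of the
     injective [eps]. *)
  have lt_mn : (n.-2.+1 < n)%N by move: (le2n); case: (n) => [|[]].
  have [I [J [theta [theta_bij fibE]]]] := step _ lt_mn.
  have [rcB locB] := rcloc _ (ltnW lt_mn).
  apply: (@iterated_step _ _ _ _ A_val _ _ _ _ _ _ idfun theta_bij fibE
    _ _ rcB locB).
    by move=> a; exists a.
  move=> a; split=> /= [->|pa0]; first by rewrite rmorph0.
  apply: eps_inj; rewrite rmorph0.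
  apply: functional_extensionality_dep => -[i lt_in].
  have lt_im : (i < n.-2.+2)%N by move: (le2n) (lt_in); case: (n) => [|[]].
  have e := congr1 (fun x : rprod A_ n.-2.+2 => x (Ordinal lt_im)) pa0.
  apply: etrans e.
  exact: rprod_Ordinal.
split; [exact/local_ringP|exact/real_closed_ringE|].
exists A_, eps; split=> // -[[|j] lt_jn]; apply/seteqP; split=> // y _.
  have [a ay] := co0 y; exists a => //.
  by rewrite -[RHS]ay; exact: rprod_Ordinal.
have [I [J [theta [[theta' _ theta'K] fibE]]]] := step j lt_jn.
(* For coordinate [j + 1], pair [y] with an element of the previous stage whose class corresponds to
   that of [y] under [theta]. *)
have [s sE] := onto_quot_map (theta' (\pi_{ideal_quot J} y)).
have [z zs zy] := ex_rcons (\val s) (y : A_ j.+1).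
have [a _ az] : range (proj lt_jn \o eps) z.
  by rewrite fibE; exists s => //; rewrite zy -[RHS]theta'K -sE.
by exists a => //; rewrite -[RHS]zy -az; exact: rprod_Ordinal.
Qed.

(** Each of the [n] minimal primes occurs among the [n] primes [p i]. The resulting injection of
    ['I_n] into itself is bijective, so every [p i] is minimal and none is repeated. *)
Lemma rank_equal_minimal (A : comNzRingType) n (p : nat -> prime_idealr A) :
  (forall a, (forall i, (i < n)%N -> a \in p i) -> a = 0) ->
  rank_equal A n ->
  (forall i, (i < n)%N -> minimal_prime (p i)) /\
  (forall i j, (i < n)%N -> (j < n)%N -> p i = p j -> i = j).
Proof.
move=> cap0 /pcard_eqP [f].
have /choice [g gE] : forall k : 'I_n, exists r, minimal_prime r /\ f r = k.
  move=> k; have [r rmin fr] : (f @` [set r | minimal_prime r]) k.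
    by rewrite image_eq; exact: ltn_ord.
  by exists r.
have /choice [h hE] : forall k : 'I_n, exists i : 'I_n, g k = p i.
  move=> k; have [i lt_in e] := minimal_prime_in_family cap0 (gE k).1.
  by exists (Ordinal lt_in).
have h_inj : injective h.
  move=> k l hkl; apply: val_inj => /=; rewrite -(gE k).2 -(gE l).2.
  by rewrite !hE hkl.
have [h' h'K hK] := injF_bij h_inj.
have pE i (lt_in : (i < n)%N) : p i = g (h' (Ordinal lt_in)) by rewrite hE hK.
split=> [i lt_in|i j lt_in lt_jn]; first by rewrite pE; exact: (gE _).1.
rewrite !pE => e; have := (gE (h' (Ordinal lt_in))).2; rewrite e (gE _).2.
move=> /val_inj /(can_inj hK) e'.
by case: e'.
Qed.

Theorem theorem3p19 (n : nat) (le2n : (2 <= n)%N) (A : comNzRingType)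
    (A_not_field : ~ is_field A) :
  [/\ local_rc_SV_rank_at_most A n <-> local_rc_subdirect A n,
      local_rc_subdirect A n <-> iterated_fibre_embedding A le2n
    & iterated_fibre_embedding A le2n <->
      (exists p q : nat -> prime_idealr A, prime_fibre_decomposition p q n)] /\
  (local_rc_SV_rank_at_most A n \/ local_rc_subdirect A n \/
   iterated_fibre_embedding A le2n \/
   (exists p q : nat -> prime_idealr A, prime_fibre_decomposition p q n) ->
   rank_equal A n ->
   forall p q : nat -> prime_idealr A, prime_fibre_decomposition p q n ->
     (forall i j, (i < n)%N -> (j < n)%N -> i <> j -> ~ {subset p i <= p j}) /\
     (forall r : prime_idealr A,
        minimal_prime r <-> exists2 i, (i < n)%N & r =i p i)).
Proof.
have ii_i := @subdirect_SV A n (ltnW le2n).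
have i_iv := @SV_prime_fibre A n le2n A_not_field.
have iv_iii : (exists p q : nat -> prime_idealr A, prime_fibre_decomposition p q n) ->
    iterated_fibre_embedding A le2n.
  by move=> [p [q pq]]; exact: prime_fibre_iterated pq.
have iii_ii := @iterated_subdirect A n le2n.
split.
  split; split=> H //; [exact/iii_ii/iv_iii/i_iv|exact/ii_i|..].
  - exact/iv_iii/i_iv/ii_i.
  - exact: iii_ii.
  - exact/i_iv/ii_i/iii_ii.
  - exact: iv_iii.
move=> _ rkA p q [cap0 _ _ _].
have [pmin pinj] := rank_equal_minimal cap0 rkA.
(* An inclusion into the minimal prime [p j] is an equality, so incomparability reduces to the
   absence of repetitions. *)
split=> [i j lt_in lt_jn neq_ij pij|r].
  apply: neq_ij; apply: pinj => //; apply: prime_idealr_ext => x.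
  by apply/idP/idP; [exact: pij|exact: pmin].
split=> [rmin|[i lt_in rp]].
  by have [i lt_in ->] := minimal_prime_in_family cap0 rmin; exists i.
by rewrite (prime_idealr_ext rp); exact: pmin.
Qed.
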